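(* There is an absolute constant $C>0$ such that for every integer $n\ge 6$ there is $k_0(n)$ such that for all integers $k\ge k_0(n)$ $$N_{LP}(n,k)\ \le\ C\, n^{-\frac12}\left(\frac{\sqrt{2e}}{n}\right)^{n-3}k^{n-1}.$$
   Context: For an integer $n\ge 3$ let $w(t)=(1-t^2)^{\frac{n-3}{2}}$ on $(-1,1)$, and let $P_s=P_s^{\frac{n-3}{2},\frac{n-3}{2}}$ ($s=0,1,2,\dots$) be the Jacobi polynomials of degree $s$, orthogonal on $(-1,1)$ with respect to the weight $w$, with the standard (Szegő) normalization $P_s(1)=\binom{s+\frac{n-3}{2}}{s}$, so $P_0\equiv 1$. The linear programming bound for spherical designs in dimension $n$ with strength $k$ is $$N_{LP}(n,k)=\sup\Big\{\frac1{a_0}:\ F=\sum_{s=0}^m a_sP_s,\ F\ge 0\text{ on }[-1,1],\ F(1)=1,\ a_s\le 0\text{ for all } s\ge k\Big\},$$ where the $a_s$ are real and the degree $m$ may be arbitrarily large. Here $e$ is the base of the natural logarithm. *)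

(* Defs.v *)
From HB Require Import structures.
From mathcomp Require Import all_boot all_order all_algebra.
From mathcomp Require Import all_classical all_reals all_analysis.
From mathcomp Require Import measurable_realfun.
Import Order.TTheory GRing.Theory Num.Theory.
Import numFieldNormedType.Exports.

Set Implicit Arguments.
Unset Strict Implicit.
Unset Printing Implicit Defensive.

Local Open Scope classical_set_scope.
Local Open Scope ring_scope.

Definition gbinom {R : realType} (x : R) (s : nat) : R :=
  (\prod_(i < s) (x - i%:R)) / (s`!)%:R.

(* The common value of the two Jacobi parameters. *)
Definition jacobi_param (R : realType) (n : nat) : R := (n%:R - 3) / 2.

Definition jacobi_weight {R : realType} (n : nat) (t : R) : R :=
  (1 - t ^+ 2) `^ jacobi_param R n.

Definition is_jacobi {R : realType} (n : nat) (P : nat -> {poly R}) : Prop :=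
  [/\ forall s, size (P s) = s.+1,
      forall r s, r != s ->
        \int[lebesgue_measure]_(t in `]-1, 1[)
          ((P r).[t] * (P s).[t] * jacobi_weight n t) = 0
    & forall s, (P s).[1] = gbinom (s%:R + jacobi_param R n) s].

(* A family as above is unique for n >= 3; [jacobiP] below shows that it exists,
   so that the default value of [xget] is never used. *)
Definition jacobi {R : realType} (n : nat) : nat -> {poly R} :=
  xget (fun=> 0) [set P | is_jacobi n P].

Definition LP_feasible {R : realType} (n k m : nat) (a : nat -> R) : Prop :=
  let F := \sum_(s < m.+1) a s *: jacobi n s in
  [/\ forall t, -1 <= t <= 1 -> 0 <= F.[t],
      F.[1] = 1
    & forall s, (k <= s <= m)%N -> a s <= 0].

(* The supremum is taken in the extended reals: its finiteness is not assumed. *)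
Definition N_LP (R : realType) (n k : nat) : \bar R :=
  ereal_sup [set x | exists m (a : nat -> R),
    LP_feasible n k m a /\ x = ((a 0%N)^-1)%:E].

Section JacobiExistence.
Context (R : realType) (n : nat) (n3 : (3 <= n)%N).

Let mu := @lebesgue_measure R.
Let I : set R := `]-1, 1[.
Let L (p : {poly R}) : R := \int[mu]_(t in I) (p.[t] * jacobi_weight n t).

Let mI : measurable I.
Proof. exact: measurable_itv. Qed.

Let muI : mu I = 2%:E.
Proof.
by rewrite /mu /I lebesgue_measure_itv/= lte_fin (lt_trans (ltrN10 R) ltr01) opprK -EFinD.
Qed.

Lemma jacobi_param_ge0 : 0 <= jacobi_param R n.
Proof. by rewrite divr_ge0// subr_ge0 ler_nat. Qed.

Lemma jacobi_weight_itv (t : R) : I t -> 0 < jacobi_weight n t <= 1.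
Proof.
rewrite /I /= in_itv/= => /andP[t1 t2].
have t3 : t ^+ 2 < 1 by rewrite -real_normK ?num_real// expr_lt1// ltr_norml t1.
rewrite powR_gt0 ?subr_gt0//=.
have := @ge0_ler_powR R _ jacobi_param_ge0 (1 - t ^+ 2) 1.
rewrite !nnegrE powR1 => ->//; first by rewrite subr_ge0 ltW.
by rewrite gerBl sqr_ge0.
Qed.

Lemma measurable_jacobi_weight (A : set R) :
  measurable_fun A (jacobi_weight n : R -> R).
Proof.
apply: (@measurable_funS _ _ _ _ setT) => //.
rewrite /jacobi_weight; apply: (@measurableT_comp _ _ _ _ _ _ (@powR R ^~ (jacobi_param R n))) => //.
by apply: measurable_funB => //; exact: measurable_funX.
Qed.

Lemma jacobi_weight_integrable (p : {poly R}) :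
  mu.-integrable I (EFin \o (fun t => p.[t] * jacobi_weight n t)).
Proof.
apply: (@measurable_bounded_integrable _ (measurableTypeR R)) => //.
- by have : (mu I < +oo)%E by rewrite muI ltry.
- apply: measurable_funM; last exact: measurable_jacobi_weight.
  apply: (@measurable_funS _ _ _ _ setT) => //.
  by apply: continuous_measurable_fun; exact: continuous_horner.
- have := @segment_compact R (-1) 1.
  have cp : {within `[-1, 1], continuous (horner p)}.
    by apply: continuous_subspaceT; exact: continuous_horner.
  move=> /(continuous_compact cp)/compact_bounded[M [_ hM]].
  exists M; split; rewrite ?num_real// => x Mx t It.
  have /andP[w0 w1] := jacobi_weight_itv It.
  rewrite /= normrM (ger0_norm (ltW w0)).
  apply: (@le_trans _ _ `|p.[t]|); first by rewrite ler_piMr.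
  apply: (hM x Mx); exists t => //.
  move: It; rewrite /I /= !in_itv/= => /andP[a b]; by rewrite !ltW.
Qed.

Let LD (p q : {poly R}) : L (p + q) = L p + L q.
Proof.
rewrite /L -RintegralD//; try exact: jacobi_weight_integrable.
by apply: eq_Rintegral => t _; rewrite hornerD mulrDl.
Qed.

Let LZ (c : R) (p : {poly R}) : L (c *: p) = c * L p.
Proof.
rewrite /L -RintegralZl//; try exact: jacobi_weight_integrable.
by apply: eq_Rintegral => t _; rewrite hornerZ mulrA.
Qed.

Let L0 : L 0 = 0.
Proof. by rewrite -[X in L X](scale0r 0) LZ mul0r. Qed.

Let L_sum m (F : 'I_m -> {poly R}) : L (\sum_i F i) = \sum_i L (F i).
Proof.
by apply: (big_morph L) => [p q|]; [exact: LD | exact: L0].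
Qed.

Let L_neq0 (p : {poly R}) : p != 0 -> (forall t, I t -> 0 <= p.[t]) -> L p != 0.
Proof.
move=> p0 pge0; apply/eqP => Lp.
have ip := jacobi_weight_integrable p.
have ge0 t : I t -> 0 <= p.[t] * jacobi_weight n t.
  by move=> It; rewrite mulr_ge0 ?pge0//; have /andP[/ltW] := jacobi_weight_itv It.
have : (\int[mu]_(t in I) `|(p.[t] * jacobi_weight n t)%:E| = 0)%E.
  rewrite -[LHS]fineK; last first.
    rewrite ge0_fin_numE ?integral_ge0//.
    by have /integrableP[] := ip.
  congr EFin; rewrite -[RHS]Lp /L /Rintegral; congr fine.
  by apply: eq_integral => t; rewrite inE => It; rewrite gee0_abs// lee_fin ge0.
move/ae_eq_integral_abs => /(_ mI).
case=> [|]; first by have /integrableP[] := ip.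
move=> N [mN N0 subN].
pose Z := [set t : R | root p t].
have Zfin : finite_set Z.
  apply: contrapT => /(@infinite_set_fset _ _ (size p))[B BZ sB].
  move/eqP: p0; apply; apply: (@roots_geq_poly_eq0 _ _ (finmap.enum_fset B)) => //.
    by apply/allP => t tB; exact: BZ.
  exact: finmap.fset_uniq.
have Z0 : mu Z = 0%E.
  by apply: countable_lebesgue_measure0; exact: finite_set_countable.
have mZ : measurable Z by apply: countable_measurable => //; exact: finite_set_countable.
have sI : I `<=` N `|` Z.
  move=> t It; have [tZ|tZ] := pselect (Z t); [by right|left].
  apply: subN => /= /(_ It)[] /eqP; rewrite mulf_eq0 => /orP[/tZ//|].
  by have /andP[/lt0r_neq0/negPf->] := jacobi_weight_itv It.
have : (mu I <= mu (N `|` Z))%E.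
  by apply: le_measure; rewrite ?inE//; exact: measurableU.
have -> : mu (N `|` Z) = 0%E by rewrite -N0; exact: measureU0.
by rewrite muI lee_fin leNgt ltr0n.
Qed.

(* The kernel of a matrix of moments gives the orthogonal polynomial up to a
   scalar. *)
Let orthopoly s : exists Q : {poly R},
  size Q = s.+1 /\ forall q : {poly R}, (size q <= s)%N -> L (Q * q) = 0.
Proof.
pose A : 'M[R]_(s.+1, s) := \matrix_(i, j) L ('X^i * 'X^j).
have : kermx A != 0.
  by rewrite -mxrank_eq0 mxrank_ker subn_eq0 -ltnNge ltnS rank_leq_col.
move=> /rowV0Pn[v /sub_kermxP vA v0].
pose Q := rVpoly v.
have orth (q : {poly R}) : (size q <= s)%N -> L (Q * q) = 0.
  move=> qs; rewrite -(poly_rV_K qs); move: (poly_rV q) => u.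
  rewrite /rVpoly [X in L (_ * X)]poly_def mulr_sumr L_sum big1// => j _.
  rewrite valK -scalerAr LZ.
  suff -> : L (Q * 'X^j) = 0 by rewrite mulr0.
  move/matrixP: vA => /(_ 0 j); rewrite !mxE => vAj.
  rewrite -[RHS]vAj.
  rewrite /Q /rVpoly poly_def mulr_suml L_sum; apply: eq_bigr => i _.
  by rewrite valK -scalerAl LZ mxE.
exists Q; split=> //; apply/eqP; rewrite eqn_leq size_poly/= ltnNge.
apply/negP => /orth QQ.
have Q0 : Q != 0.
  apply: contraNneq v0 => Q0; apply/eqP.
  by rewrite -(rVpolyK v) -/Q Q0 linear0.
suff : L (Q * Q) != 0 by rewrite QQ eqxx.
by apply: L_neq0 => [|t _]; rewrite ?mulf_neq0// hornerM -expr2 sqr_ge0.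
Qed.

Lemma gbinom_jacobi_gt0 s : 0 < gbinom (s%:R + jacobi_param R n) s.
Proof.
rewrite divr_gt0 ?ltr0n ?fact_gt0// prodr_gt0// => i _.
rewrite addrAC ltr_wpDr ?jacobi_param_ge0// subr_gt0 ltr_nat.
exact: ltn_ord.
Qed.

Lemma jacobi_exists : exists P : nat -> {poly R}, is_jacobi n P.
Proof.
have /choice[P HP] : forall s, exists Q : {poly R},
    [/\ size Q = s.+1, Q.[1] = gbinom (s%:R + jacobi_param R n) s
      & forall q : {poly R}, (size q <= s)%N -> L (Q * q) = 0].
  move=> s; have [Q [sQ orth]] := orthopoly s.
  have Q0 : Q != 0 by rewrite -size_poly_eq0 sQ.
  have Q1 : Q.[1] != 0.
    apply/negP => /factor_theorem[q Qq].
    have q0 : q != 0 by apply: contraNneq Q0 => q0; rewrite Qq q0 mul0r.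
    have sq : (size q <= s)%N.
      by move: sQ; rewrite Qq size_Mmonic ?monicXsubC// size_XsubC addn2/= => -[->].
    have : L (- (Q * q)) != 0.
      apply: L_neq0; first by rewrite oppr_eq0 mulf_neq0.
      move=> t; rewrite /I /= in_itv/= => /andP[_ t1].
      rewrite Qq mulrAC -mulrN hornerM mulr_ge0//.
        by rewrite hornerM -expr2 sqr_ge0.
      by rewrite hornerN hornerXsubC oppr_ge0 subr_le0 ltW.
    by rewrite -scaleN1r LZ orth// mulr0 eqxx.
  exists ((gbinom (s%:R + jacobi_param R n) s / Q.[1]) *: Q); split.
  - by rewrite size_scale// mulf_neq0 ?invr_eq0// gt_eqF// gbinom_jacobi_gt0.
  - by rewrite hornerZ divfK.
  - by move=> q /orth Qq; rewrite -scalerAl LZ Qq mulr0.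
exists P; split=> [s|r s rs|s]; try by have [] := HP s.
transitivity (L (P r * P s)).
  by apply: eq_Rintegral => t _; rewrite hornerM.
have [sr _ or] := HP r; have [ss _ os] := HP s.
have [lt|lt|e] := ltngtP r s.
- by rewrite mulrC os// sr.
- by rewrite or// ss.
- by rewrite e eqxx in rs.
Qed.

Lemma jacobiP : is_jacobi n (@jacobi R n).
Proof.
rewrite /jacobi; case: xgetP => [P _ //|].
by have [P HP] := jacobi_exists => /(_ P).
Qed.

End JacobiExistence.

(* Main.v *)
Require Import Defs.
From HB Require Import structures.
From mathcomp Require Import all_boot all_order all_algebra.
From mathcomp Require Import all_classical all_reals all_analysis.
From mathcomp Require Import measurable_realfun polyrcf.
From mathcomp Require Import ring lra zify.
Import Order.TTheory GRing.Theory Num.Theory.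
Import numFieldNormedType.Exports.

(** Let lam = (n - 2) / 2, let L be integration against the weight, and let y be
    the Gegenbauer polynomial of even degree m, with m = k or m = k + 1.  Since
    psi = X y' - m y represents p |-> lam (p(1) + p(-1)) L 1 on polynomials p of
    degree < m, the functional
      p |-> lam eta (p(1) + p(-1)) + L (p (1 - eta (psi - B y))) / L 1
    is 1 on P_0, vanishes on P_1, ..., P_(k-1) and is nonnegative on the other
    P_s, for all eta, B >= 0.  If moreover eta (psi - B y) <= 1 on [-1, 1], it is
    at least lam eta on every feasible F, so that a_0 >= lam eta.

    With t1^2 = 1 - lam^2 / (m + lam)^2 and B = (m + lam)^2 t1 / lam, a Riccati
    argument gives y > 0 and y' <= B y on [t1, 1], hence psi <= B y there.  On
    [0, t1] the energy of the Liouville normal form of the Gegenbauer equation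
    is monotone, which bounds y and y' by y(0).  This allows eta with
    1 / (lam eta)^2 = 16 lam ((m + lam) / lam)^(n + 2) y(0)^2, and
    y(0) = +- (lam)_(m/2) / (m/2)! is estimated by induction on n with step 2. *)

Set Implicit Arguments.
Unset Strict Implicit.
Unset Printing Implicit Defensive.

Local Open Scope classical_set_scope.
Local Open Scope ring_scope.

(** * Gegenbauer polynomials *)

Definition rising {R : realFieldType} (a : R) (k : nat) : R :=
  \prod_(i < k) (a + i%:R).

(** The argument [q] is half the degree: this is C_(2q)^(lam), given by its explicit expansion in
    powers of 2X. *)
Definition gegenbauer {R : realFieldType} (lam : R) (q : nat) : {poly R} :=
  \poly_(j < q.*2.+1) (if odd j then 0 else
    (-1) ^+ (q - j./2) * rising lam (q + j./2) * 4 ^+ j./2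
      / ((q - j./2)`!%:R * j`!%:R)).

Section Gegenbauer.
Context {R : realFieldType} (lam : R).
Implicit Types (q : nat).

Lemma risingS (a : R) k : rising a k.+1 = rising a k * (a + k%:R).
Proof. by rewrite /rising big_ord_recr. Qed.

Lemma size_gegenbauer q : (size (gegenbauer lam q) <= q.*2.+1)%N.
Proof. exact: size_poly. Qed.

Lemma coef_gegenbauer_odd q j : odd j -> (gegenbauer lam q)`_j = 0.
Proof. by move=> oj; rewrite coef_poly oj; case: ifP. Qed.

Lemma coef_gegenbauer_even q i d : q = (i + d)%N ->
  (gegenbauer lam q)`_i.*2 =
    (-1) ^+ d * rising lam (q + i) * 4 ^+ i / (d`!%:R * (i.*2)`!%:R).
Proof.
move=> ->; rewrite coef_poly odd_double doubleK ltnS leq_double leq_addr.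
by rewrite addnC addnK.
Qed.

Lemma coef_gegenbauer_big q j : (q.*2 < j)%N -> (gegenbauer lam q)`_j = 0.
Proof. by move=> h; rewrite coef_poly ltnNge h. Qed.

(** This is the Gegenbauer differential equation read coefficient by coefficient. *)
Lemma coef_gegenbauerSS q j :
  (gegenbauer lam q)`_j.+2 * (j.+2%:R * j.+1%:R) =
  (j%:R - q.*2%:R) * (j%:R + q.*2%:R + 2 * lam) * (gegenbauer lam q)`_j.
Proof.
have [oj|] := boolP (odd j).
  by rewrite !coef_gegenbauer_odd ?mul0r ?mulr0//= negbK.
move=> /even_halfK <-; set i := j./2.
have [lt|ge] := ltnP q i.
  by rewrite !coef_gegenbauer_big ?mulr0 ?mul0r//; lia.
have [d qE] : exists d, q = (i + d)%N by exists (q - i)%N; lia.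
case: d qE => [|d] qE.
  have -> : q.*2 = i.*2 by rewrite qE addn0.
  by rewrite coef_gegenbauer_big ?subrr ?mul0r//; lia.
rewrite -doubleS (@coef_gegenbauer_even q i.+1 d); last by lia.
rewrite (coef_gegenbauer_even qE) addnS risingS.
rewrite doubleS !factS !exprS !natrM.
have f1 : (d`!%:R : R) != 0 by rewrite pnatr_eq0 -lt0n fact_gt0.
have f2 : (i.*2`!%:R : R) != 0 by rewrite pnatr_eq0 -lt0n fact_gt0.
have qR : q%:R = i%:R + d%:R + 1 :> R by rewrite qE natrD -natr1 addrA.
set a := (-1) ^+ d; set b := 4 ^+ i; set r := rising _ _.
set u := d`!%:R in f1 *; set v := i.*2`!%:R in f2 *.
have dq : q.*2%:R = (i%:R + d%:R + 1) * 2 :> R by rewrite -muln2 natrM qR.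
have di : i.*2%:R = i%:R * 2 :> R by rewrite -muln2 natrM.
rewrite dq -(natr1 i.*2.+1) -(natr1 i.*2) di -(natr1 d) natrD qR.
have i0 : 0 <= i%:R :> R by exact: ler0n.
have d0 : 0 <= d%:R :> R by exact: ler0n.
field; rewrite f1 f2 /=.
by apply/and3P; split; apply: lt0r_neq0; lra.
Qed.

Lemma gegenbauer_ode q (y := gegenbauer lam q) :
  (1 - 'X^2) * y^`()^`() - (2 * lam + 1) *: ('X * y^`())
    + (q.*2%:R * (q.*2%:R + 2 * lam)) *: y = 0.
Proof.
apply/polyP => j; have := coef_gegenbauerSS q j; rewrite -/y => yj.
have D (p : {poly R}) i : p^`()`_i = p`_i.+1 * i.+1%:R by rewrite coef_deriv mulr_natr.
rewrite mulrBl mul1r !(coefD, coefN, coefZ, coefXM, coefXnM) coef0 !D.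
case: j yj => [|[|j]] /= yj; rewrite ?subn2 /= ?D.
- lra.
- lra.
- move: yj; rewrite -!(natr1 j.+3) -!(natr1 j.+2) -!(natr1 j.+1) -!(natr1 j).
  by move: (y`_j.+4) (y`_j.+2) (j%:R) (q.*2%:R) => u v a b h; lra.
Qed.

(* The polynomial psi of the header. *)
Definition gegenker q : {poly R} :=
  'X * (gegenbauer lam q)^`() - q.*2%:R *: gegenbauer lam q.

Lemma coef_gegenker q j :
  (gegenker q)`_j = (j%:R - q.*2%:R) * (gegenbauer lam q)`_j.
Proof.
rewrite coefB coefZ coefXM coef_deriv.
case: j => [|j]/=; first by ring.
by rewrite -(mulr_natr (_`_ _)); ring.
Qed.

(** Classically psi is the derivative of C_(2q-1)^(lam), and this is the identity C_(j+1)' -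
    C_(j-1)' = 2 (j + lam) C_j at j = 2q. *)
Lemma gegenkerS q :
  gegenker q.+1 = gegenker q + (2 * lam + 2 * q.*2%:R) *: gegenbauer lam q.
Proof.
apply/polyP => j; rewrite coefD coefZ !coef_gegenker.
have [oj|] := boolP (odd j).
  by rewrite !coef_gegenbauer_odd// !mulr0 addr0.
move=> /even_halfK <-; set i := j./2.
have [lt|] := ltnP q.+1 i.
  by rewrite !coef_gegenbauer_big ?mulr0 ?addr0//; lia.
rewrite leq_eqVlt => /orP[/eqP->|le].
  by rewrite subrr mul0r [X in _ * X + _ * X]coef_gegenbauer_big ?mulr0 ?addr0//; lia.
have [d qE] : exists d, q = (i + d)%N by exists (q - i)%N; lia.
rewrite (coef_gegenbauer_even qE) (@coef_gegenbauer_even _ i d.+1); last by lia.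
have f1 : (d`!%:R : R) != 0 by rewrite pnatr_eq0 -lt0n fact_gt0.
have f2 : (i.*2`!%:R : R) != 0 by rewrite pnatr_eq0 -lt0n fact_gt0.
rewrite addSn risingS factS natrM exprS.
set a := (-1) ^+ d; set b := 4 ^+ i; set r := rising _ _.
set u := d`!%:R in f1 *; set v := i.*2`!%:R in f2 *.
rewrite -!muln2 !natrM -natr1 -[d.+1%:R]natr1 qE !natrD.
have d0 : 0 <= d%:R :> R by exact: ler0n.
field; rewrite f1 f2 /=; apply: lt0r_neq0; lra.
Qed.

Lemma gegenbauer_deriv1 q :
  (2 * lam + 1) * (gegenbauer lam q)^`().[1] =
  q.*2%:R * (q.*2%:R + 2 * lam) * (gegenbauer lam q).[1].
Proof.
have := congr1 (horner^~ 1) (gegenbauer_ode q).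
by rewrite !hornerE expr1n /= => h; lra.
Qed.

(** The equation at 1 expresses y'(1), hence psi(1), through y(1); inserting this in [gegenkerS]
    leaves a recurrence for y(1) alone. *)
Lemma gegenbauer1S q : 0 <= lam ->
  (q.*2%:R + 2) * (q.*2%:R + 1) * (gegenbauer lam q.+1).[1] =
  (q.*2%:R + 2 * lam) * (q.*2%:R + 2 * lam + 1) * (gegenbauer lam q).[1].
Proof.
move=> lam0.
have := congr1 (horner^~ 1) (gegenkerS q); rewrite /gegenker !hornerE /=.
have := gegenbauer_deriv1 q; have := gegenbauer_deriv1 q.+1.
set dS := (gegenbauer lam q.+1)^`().[1]; set yS := (gegenbauer lam q.+1).[1].
set d := (gegenbauer lam q)^`().[1]; set y := (gegenbauer lam q).[1].
rewrite doubleS -addn2 natrD; set m := q.*2%:R => hS h /(congr1 ( *%R (2 * lam + 1))).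
by rewrite /= => e; lra.
Qed.

Lemma gegenbauer0 : gegenbauer lam 0 = 1.
Proof.
apply/polyP => j; rewrite coef1 coef_poly; case: j => [|[|j]]//=.
by rewrite /rising big_ord0 !expr0 fact0 !mulr1 divr1.
Qed.

Lemma gegenbauer_gt0_at1 q : 0 < lam -> 0 < (gegenbauer lam q).[1].
Proof.
move=> lam0; elim: q => [|q IH]; first by rewrite gegenbauer0 hornerC.
have m0 : 0 <= q.*2%:R :> R by exact: ler0n.
have /eqP := gegenbauer1S q (ltW lam0).
have a0 : 0 < (q.*2%:R + 2) * (q.*2%:R + 1) :> R by rewrite mulr_gt0//; lra.
have b0 : 0 < (q.*2%:R + 2 * lam) * (q.*2%:R + 2 * lam + 1) :> R.
  by rewrite mulr_gt0//; lra.
by move=> /eqP h; rewrite -(pmulr_rgt0 _ a0) h mulr_gt0.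
Qed.

Lemma gegenbauer_at0 q : (gegenbauer lam q).[0] = (-1) ^+ q * (rising lam q / q`!%:R).
Proof.
rewrite horner_coef0 (@coef_gegenbauer_even q 0 q)// addn0 expr0 fact0.
by rewrite !mulr1 mulrA.
Qed.

Lemma gegenbauer_deriv_at0 q : (gegenbauer lam q)^`().[0] = 0.
Proof. by rewrite horner_coef0 coef_deriv coef_gegenbauer_odd// mul0rn. Qed.

End Gegenbauer.

(** * Bounds on Gegenbauer polynomials *)

Section PolyPositive.
Context {R : rcfType}.
Implicit Types (p : {poly R}) (a b c t : R).

Lemma poly_gt0_noroot p c b : (forall t, c < t < b -> ~~ root p t) -> 0 < p.[b] ->
  forall t, c < t <= b -> 0 < p.[t].
Proof.
move=> nr pb t /andP[ct]; rewrite le_eqVlt => /predU1P[->//|tb].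
rewrite ltNge; apply/negP => pt.
have [x] := @polyrcf.poly_ivt R p t b (ltW tb) (mulr_le0_ge0 pt (ltW pb)).
rewrite in_itv/= => /andP[tx xb] rx.
have xb' : x < b.
  by rewrite lt_neqAle xb andbT; apply: contraTneq rx => ->; rewrite rootE gt_eqF.
suff /nr : c < x < b by rewrite rx.
by rewrite (lt_le_trans ct tx).
Qed.

Lemma poly_ge0_noroot p c b : c < b -> (forall t, c < t < b -> ~~ root p t) ->
  0 < p.[b] -> 0 <= p.[c].
Proof.
move=> cb nr pb; rewrite leNgt; apply/negP => pc.
have pcb : p.[c] * p.[b] < 0 by rewrite nmulr_rlt0.
have [x] := @polyrcf.poly_ivtoo R p c b (ltW cb) pcb.
by rewrite in_itv/= => /nr/negP.
Qed.

Lemma poly_last_root p a b : root p a -> a < b -> 0 < p.[b] ->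
  exists c, [/\ a <= c < b, root p c & forall t, c < t < b -> ~~ root p t].
Proof.
move=> pa ab pb; have p0 : p != 0 by apply: contraTneq pb => ->; rewrite horner0 ltxx.
case: (prev_rootP p a b) => [/eqP|c _ pc cab nr|c _ cE nr]; first by rewrite (negPf p0).
  exists c; split; [|exact/eqP|by move=> t tcb; apply: nr; rewrite in_itv].
  by move: cab; rewrite in_itv/= => /andP[/ltW -> ->].
exists a; split; [by rewrite lexx|exact: pa|].
by move=> t tab; apply: nr; rewrite in_itv.
Qed.
End PolyPositive.

(** * The logarithmic derivative near 1 *)

Section Riccati.
Context {R : rcfType}.

(* The region y > 0, y' < B y is invariant when t decreases from 1. *)
Lemma ultraspherical_logderiv_lt (y : {poly R}) (lam M B t1 : R) :
  (1 - 'X^2) * y^`()^`() - (2 * lam + 1) *: ('X * y^`()) + M *: y = 0 ->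
  0 <= t1 -> t1 < 1 ->
  (forall t, t1 <= t <= 1 -> (1 - t ^+ 2) * B ^+ 2 - (2 * lam + 1) * t * B + M < 0) ->
  0 < y.[1] -> 0 < 2 * lam + 1 ->
  forall t, t1 <= t <= 1 -> 0 < y.[t] /\ y^`().[t] < B * y.[t].
Proof.
move=> ode t1_ge0 t11 disc y1 l1.
have odet t : (1 - t ^+ 2) * y^`()^`().[t] = (2 * lam + 1) * t * y^`().[t] - M * y.[t].
  have := congr1 (horner^~ t) ode; rewrite !hornerE /= => h; lra.
pose f := B *: y - y^`().
have fE t : f.[t] = B * y.[t] - y^`().[t] by rewrite /f !hornerE.
(* At 1 the equation reads (2 lam + 1) y'(1) = M y(1), while [disc] gives M < (2 lam + 1) B. *)
have f1 : 0 < f.[1].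
  have := odet 1; have := disc 1; rewrite expr1n subrr !mul0r mulr1 lexx andbT fE => /(_ (ltW t11)) h e.
  rewrite -(pmulr_rgt0 _ l1); nra.
(* There is no first exit from the region: if neither y nor f has a root in (c, 1), neither vanishes
   at c. *)
have nice c : t1 <= c < 1 -> (forall t, c < t < 1 -> ~~ root (y * f) t) ->
    ~~ root (y * f) c.
  move=> /andP[t1c c1] nr.
  have nry t : c < t < 1 -> ~~ root y t.
    by move=> /nr; rewrite rootM negb_or => /andP[].
  have nrf t : c < t < 1 -> ~~ root f t.
    by move=> /nr; rewrite rootM negb_or => /andP[].
  have [k [h hc yE]] := multiplicity_XsubC y c.
  have y0 : y != 0 by apply: contraTneq y1 => ->; rewrite horner0 ltxx.
  move: hc; rewrite y0/= => hc.
  have h1 : 0 < h.[1].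
    move: y1; rewrite yE hornerM horner_exp hornerXsubC pmulr_lgt0//.
    by rewrite exprn_gt0// subr_gt0.
  have hc0 : 0 < h.[c].
    rewrite lt_neqAle eq_sym hc/=; apply: poly_ge0_noroot c1 _ h1 => t tc.
    by have := nry t tc; rewrite yE rootM negb_or => /andP[].
  case: k yE => [|k] yE.
    have yc : 0 < y.[c] by rewrite yE expr0 mulr1.
    (* If f(c) = 0 then y'(c) = B y(c), and the equation makes (1 - c^2) f'(c) equal to the negative
       expression of [disc] times y(c) > 0. But f > 0 on (c, 1) forces f'(c) >= 0. *)
    rewrite rootM negb_or rootE gt_eqF//=; apply/negP => /factor_theorem[g gE].
    have g1 : 0 < g.[1].
      by move: f1; rewrite gE hornerM hornerXsubC pmulr_lgt0// subr_gt0.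
    have gc : 0 <= g.[c].
      apply: poly_ge0_noroot c1 _ g1 => t tc.
      by have := nrf t tc; rewrite gE rootM negb_or => /andP[].
    have f'c : f^`().[c] = g.[c].
      by rewrite gE derivM derivXsubC !hornerE /= subrr mulr0 add0r.
    have := fE c; rewrite gE hornerM hornerXsubC subrr mulr0 => /esym/eqP.
    rewrite subr_eq0 => /eqP y'c.
    have f'E : f^`().[c] = B * y^`().[c] - y^`()^`().[c].
      by rewrite /f derivB derivZ !hornerE.
    have v0 : 0 < 1 - c ^+ 2 by nra.
    have := disc c; rewrite t1c (ltW c1) => /(_ isT) dc.
    have := odet c; rewrite -y'c => oc.
    have : (1 - c ^+ 2) * g.[c] < 0.
      rewrite -f'c f'E -y'c mulrBr oc.
      have -> : (1 - c ^+ 2) * (B * (B * y.[c])) -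
        ((2 * lam + 1) * c * (B * y.[c]) - M * y.[c]) =
        ((1 - c ^+ 2) * B ^+ 2 - (2 * lam + 1) * c * B + M) * y.[c] by ring.
      by rewrite nmulr_rlt0.
    by rewrite pmulr_rlt0// ltNge gc.
  (* If y has a zero of order k + 1 at c, then f = (X - c)^k b with b(c) = - (k + 1) h(c) < 0,
     whereas f > 0 on (c, 1) forces b(c) >= 0. *)
  pose b := B *: (('X - c%:P) * h) - k.+1%:R *: h - ('X - c%:P) * h^`().
  have fb : f = ('X - c%:P) ^+ k * b.
    rewrite /f yE derivM deriv_exp derivXsubC /b -scaler_nat exprS /= -!mul_polyC.
    by rewrite polyC_natr; ring.
  have b1 : 0 < b.[1].
    by move: f1; rewrite fb hornerM horner_exp hornerXsubC pmulr_rgt0// exprn_gt0// subr_gt0.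
  have : 0 <= b.[c].
    apply: poly_ge0_noroot c1 _ b1 => t tc.
    by have := nrf t tc; rewrite fb rootM negb_or => /andP[].
  have -> : b.[c] = - (k.+1%:R * h.[c]).
    by rewrite /b !(hornerD, hornerN, hornerZ, hornerM, hornerX, hornerC) subrr !mul0r; ring.
  by rewrite oppr_ge0 leNgt mulr_gt0// ltr0n.
have noroot t : t1 <= t < 1 -> ~~ root (y * f) t.
  move=> /andP[t1t tlt]; apply/negP => rt.
  have yf1 : 0 < (y * f).[1] by rewrite hornerM mulr_gt0.
  have [c [/andP[tc c1] rc nr]] := poly_last_root rt tlt yf1.
  by move: rc; apply/negP/nice => //; rewrite (le_trans t1t).
have t1_noroot t : t1 <= t < 1 -> ~~ root y t && ~~ root f t.
  by move=> /noroot; rewrite rootM negb_or.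
have pos p : (forall t, t1 <= t < 1 -> ~~ root p t) -> 0 < p.[1] ->
    forall t, t1 <= t <= 1 -> 0 < p.[t].
  move=> nr p1 t /andP[]; rewrite le_eqVlt => /predU1P[<- _|t1t tle].
    rewrite lt_neqAle eq_sym -rootE nr ?lexx//=.
    by apply: poly_ge0_noroot t11 _ p1 => x /andP[/ltW a b]; rewrite nr ?a.
  apply: (@poly_gt0_noroot _ p t1 1) => //; last by rewrite t1t.
  by move=> x /andP[/ltW a b]; rewrite nr ?a.
move=> t tt; split; first by apply: pos tt => // x /t1_noroot/andP[].
by rewrite -subr_gt0 -fE; apply: pos tt => // x /t1_noroot/andP[].
Qed.
End Riccati.

Lemma ultraspherical_ode_at {R : comNzRingType} (y : {poly R}) (lam M : R) :
  (1 - 'X^2) * y^`()^`() - (2 * lam + 1) *: ('X * y^`()) + M *: y = 0 ->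
  forall t, (1 - t ^+ 2) * y^`()^`().[t] - (2 * lam + 1) * (t * y^`().[t]) + M * y.[t] = 0.
Proof.
move=> ode t; have := congr1 (horner^~ t) ode.
by rewrite !(hornerD, hornerN, hornerM, hornerZ, hornerXn, hornerX, hornerC).
Qed.

(** * Monotonicity of the energy *)

Section Energy.
Context {R : rcfType}.

(* Up to a power of 1 - t^2, this is u'^2 + Q u^2 for u = sin^lam y(cos), which
   solves u'' + Q u = 0 with Q increasing on (0, pi / 2). *)
Definition energy (y : {poly R}) (lam M : R) : {poly R} :=
  ((1 - 'X^2) * y^`() - lam *: ('X * y)) ^+ 2
  + ((M + lam ^+ 2) *: (1 - 'X^2) - (lam * (lam - 1))%:P) * y ^+ 2.

Lemma energyE y lam M t : (energy y lam M).[t] =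
  ((1 - t ^+ 2) * y^`().[t] - lam * (t * y.[t])) ^+ 2
  + ((M + lam ^+ 2) * (1 - t ^+ 2) - lam * (lam - 1)) * y.[t] ^+ 2.
Proof.
by rewrite /energy !(hornerD, hornerN, hornerM, hornerZ, hornerXn, hornerX, hornerC, horner_exp).
Qed.

(** Multiplied by (1 - t^2)^(lam - 2), the left side becomes the derivative of (1 - t^2)^(lam - 1)
    times the energy. The right side is nonpositive for t >= 0 and lam >= 1. *)
Lemma energy_deriv y lam M t :
  (1 - 'X^2) * y^`()^`() - (2 * lam + 1) *: ('X * y^`()) + M *: y = 0 ->
  (1 - t ^+ 2) * (energy y lam M)^`().[t] - 2 * (lam - 1) * t * (energy y lam M).[t] =
  - 2 * lam * (lam - 1) * t * y.[t] ^+ 2.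
Proof.
move=> /ultraspherical_ode_at/(_ t); rewrite energyE.
have -> : (energy y lam M)^`().[t] =
  2 * ((1 - t ^+ 2) * y^`().[t] - lam * (t * y.[t])) *
    ((1 - t ^+ 2) * y^`()^`().[t] - 2 * t * y^`().[t] - lam * (y.[t] + t * y^`().[t]))
  - 2 * t * (M + lam ^+ 2) * y.[t] ^+ 2
  + ((M + lam ^+ 2) * (1 - t ^+ 2) - lam * (lam - 1)) * (2 * y.[t] * y^`().[t]).
  rewrite /energy !expr2 !poly.derivE.
  rewrite !(hornerD, hornerN, hornerM, hornerZ, hornerXn, hornerX, hornerC, hornerMn).
  ring.
move: (y.[t]) (y^`().[t]) (y^`()^`().[t]) => a b c h.
have {h} : (1 - t ^+ 2) * c = (2 * lam + 1) * (t * b) - M * a by lra.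
move=> ->; ring.
Qed.

(** Since lam may be a half-integer, the monotone quantity is squared: 2 (lam - 1) = N - 2 is a
    natural number, and the mean value theorem for polynomials applies. The bound on lam (lam - 1)
    keeps the energy nonnegative on [0, t], so that its square is monotone too. *)
Lemma energy_decay y lam M N t : lam = N%:R / 2 -> (4 <= N)%N ->
  (1 - 'X^2) * y^`()^`() - (2 * lam + 1) *: ('X * y^`()) + M *: y = 0 ->
  0 <= t -> lam * (lam - 1) <= (M + lam ^+ 2) * (1 - t ^+ 2) -> 0 < 1 - t ^+ 2 ->
  0 <= M ->
  (1 - t ^+ 2) ^+ (N - 2) * (energy y lam M).[t] ^+ 2 <= (energy y lam M).[0] ^+ 2.
Proof.
case: N => [|[|[|[|N]]]]// lamN _ ode t0 tl v0 M0; rewrite subSS subSS subn0.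
have N4R : 4 <= N.+4%:R :> R by rewrite (ler_nat _ 4).
have l2 : 2 <= lam by rewrite lamN; lra.
have := @energy_deriv y lam M; have := @energyE y lam M.
move: (energy y lam M) => e eE e'E.
pose H := (1 - 'X^2) ^+ N.+2 * e ^+ 2.
have HE x : H.[x] = (1 - x ^+ 2) ^+ N.+2 * e.[x] ^+ 2.
  by rewrite /H hornerM !horner_exp !(hornerD, hornerN, horner_exp, hornerX, hornerC).
move: t0; rewrite le_eqVlt => /predU1P[<-|t0].
  by rewrite expr0n subr0 expr1n mul1r.
have [c] := poly_mvt H t0; rewrite in_itv/= => /andP[c0 ct].
have <- : H.[0] = e.[0] ^+ 2 by rewrite HE expr0n subr0 expr1n mul1r.
rewrite -HE subr0 => Ht; rewrite -subr_le0 Ht.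
rewrite pmulr_lle0//.
have vc : 0 < 1 - c ^+ 2 by nra.
have ec : 0 <= e.[c].
  rewrite eE addr_ge0 ?sqr_ge0// mulr_ge0 ?sqr_ge0// subr_ge0 (le_trans tl)//.
  by rewrite ler_wpM2l ?addr_ge0 ?sqr_ge0//; nra.
rewrite -(pmulr_rle0 _ vc).
have dH : H^`().[c] = N.+2%:R * (1 - c ^+ 2) ^+ N.+1 * (- (2 * c)) * e.[c] ^+ 2
    + (1 - c ^+ 2) ^+ N.+2 * (2 * e.[c] * e^`().[c]).
  have dV : ((1 - 'X^2 : {poly R}) ^+ N.+2)^`() = N.+2%:R *: ((1 - 'X^2) ^+ N.+1 * - (2%:R *: 'X)).
    rewrite deriv_exp derivB derivC derivXn sub0r expr1 mulrC.
    by rewrite -(scaler_nat 2 'X) -(scaler_nat N.+2).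
  rewrite /H derivM [e ^+ 2]expr2 (derivM e e) dV hornerD !(hornerM, hornerZ, hornerN).
  rewrite !horner_exp !(hornerD, hornerN, hornerM, horner_exp, hornerX, hornerC).
  rewrite (exprS _ N.+1) !expr2; move: (_ ^+ N.+1) (N.+2%:R) => u w; ring.
have -> : (1 - c ^+ 2) * H^`().[c] = 2 * (1 - c ^+ 2) ^+ N.+2 * e.[c] *
    ((1 - c ^+ 2) * e^`().[c] - 2 * (lam - 1) * c * e.[c]).
  have lam1 : 2 * (lam - 1) = N.+2%:R by rewrite lamN -!natr1; field.
  rewrite lam1 dH [_ ^+ N.+2]exprS.
  by move: (_ ^+ N.+1) (N.+2%:R) => u w; ring.
have ly : 0 <= lam * (lam - 1) * c * y.[c] ^+ 2.
  by rewrite mulr_ge0 ?sqr_ge0// mulr_ge0 ?(ltW c0)// mulr_ge0//; lra.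
have ve : 0 <= 2 * (1 - c ^+ 2) ^+ N.+2 * e.[c].
  by rewrite mulr_ge0// mulr_ge0// exprn_ge0// ltW.
rewrite e'E//; apply: mulr_ge0_le0 ve _; lra.
Qed.
End Energy.

Lemma comp_polyN_even {R : realFieldType} (p : {poly R}) :
  (forall j, odd j -> p`_j = 0) -> p \Po - 'X = p.
Proof.
move=> p_odd; rewrite comp_polyE -[RHS]coefK poly_def.
apply: eq_bigr => j _; have [/p_odd->|oj] := boolP (odd j); first by rewrite !scale0r.
by rewrite exprNn -signr_odd (negPf oj) mul1r.
Qed.

(** * The upper bound for psi - B y on [-1, 1] *)

Section GegenbauerBound.
Context {R : rcfType} (lam : R) (N q : nat).
Context (lamN : lam = N%:R / 2) (N4 : (4 <= N)%N) (q0 : (0 < q)%N).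
Let y := gegenbauer lam q.
Let m : R := q.*2%:R.
Let z := (m + lam) / lam.
Let t1 := Num.sqrt (m * (m + 2 * lam)) / (m + lam).
Let B := lam * z ^+ 2 * t1.

Let lam2 : 2 <= lam.
Proof. by have : 4 <= N%:R :> R by [rewrite (ler_nat _ 4)|]; rewrite lamN; lra. Qed.

Let m2 : 2 <= m.
Proof. by rewrite (ler_nat _ 2) (leq_double 1). Qed.

Let M0 : 0 < m * (m + 2 * lam).
Proof. by rewrite mulr_gt0//; have := lam2; have := m2; lra. Qed.

Let ml : m + lam = lam * z.
Proof. by rewrite /z mulrC divfK//; have := lam2; lra. Qed.

Let z1 : 1 <= z.
Proof. by rewrite /z ler_pdivlMr; have := lam2; have := m2; lra. Qed.

Let ml0 : 0 < m + lam.
Proof. by have := lam2; have := m2; lra. Qed.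

Let t1_ge0 : 0 <= t1.
Proof. by rewrite divr_ge0 ?sqrtr_ge0 ?ltW. Qed.

Let t1sq : (m + lam) ^+ 2 * t1 ^+ 2 = m * (m + 2 * lam).
Proof. by rewrite -exprMn /t1 mulrC divfK ?gt_eqF// sqr_sqrtr ?ltW. Qed.

Let t1_lt1 : t1 < 1.
Proof.
rewrite -(@ltr_pXn2r _ 2) ?nnegrE// expr1n -(ltr_pM2l (exprn_gt0 2 ml0)) t1sq mulr1.
by have := lam2; have := m2; nra.
Qed.

Let B_ge0 : 0 <= B.
Proof. by rewrite mulr_ge0// mulr_ge0 ?sqr_ge0//; have := lam2; lra. Qed.

Let B_le : B <= lam * z ^+ 2.
Proof. by rewrite /B ler_piMr ?(ltW t1_lt1)// mulr_ge0 ?sqr_ge0//; have := lam2; lra. Qed.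

(* With t1^2 = M / (m + lam)^2 and B = (m + lam)^2 t1 / lam, the three terms of
   the discriminant are at most M, - (2 + 1 / lam) M and M. *)
Let near1 t : t1 <= t <= 1 -> 0 < y.[t] /\ y^`().[t] < B * y.[t].
Proof.
have l0 : 0 < lam by have := lam2; lra.
apply: (ultraspherical_logderiv_lt (gegenbauer_ode lam q)) => //; last 2 first.
- exact: gegenbauer_gt0_at1.
- by lra.
move=> {}t /andP[t1t t_le]; rewrite -/m.
have z2 : lam ^+ 2 * z ^+ 2 = (m + lam) ^+ 2 by rewrite -exprMn -ml.
have B2 : lam ^+ 2 * (1 - t1 ^+ 2) * B ^+ 2 = lam ^+ 2 * (m * (m + 2 * lam)).
  have -> : lam ^+ 2 * (1 - t1 ^+ 2) * B ^+ 2 =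
     (lam ^+ 2 * z ^+ 2 - lam ^+ 2 * z ^+ 2 * t1 ^+ 2) * (lam ^+ 2 * z ^+ 2 * t1 ^+ 2).
    by rewrite /B; ring.
  by rewrite z2 t1sq; ring.
have tB : lam * (t1 * B) = m * (m + 2 * lam).
  by rewrite -t1sq -z2 /B; ring.
have h1 : (1 - t ^+ 2) * B ^+ 2 <= m * (m + 2 * lam).
  rewrite -(ler_pM2l (exprn_gt0 2 l0)) -B2 -mulrA ler_pM2l ?exprn_gt0//.
  by rewrite ler_wpM2r ?sqr_ge0// lerB// ler_pXn2r ?nnegrE// (le_trans t1_ge0).
have h2 : t1 * B <= t * B by rewrite ler_wpM2r.
have h3 : lam * (t1 * B) <= lam * (t * B) by rewrite ler_pM2l.
have h4 : 0 < t1 * B by rewrite -(pmulr_rgt0 _ l0) tB.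
have := M0; move: h1 h2 h3 h4 tB; nra.
Qed.

(** On [0, t1] one has 1 - t^2 >= 1 / z^2, so the decay of the energy costs a factor z^(N - 2), and
    the coefficient of y^2 in the energy is at least lam. Hence the energy is at most lam^2 z^N
    y(0)^2, which bounds y and y' separately. *)
Let near0 t : 0 <= t <= t1 ->
  (t * y^`().[t] - (m + B) * y.[t]) ^+ 2 <= 16 * lam ^+ 3 * z ^+ (N + 4) * y.[0] ^+ 2.
Proof.
move=> /andP[t0 tt1]; have l2 := lam2; have z1' := z1.
have l0 : 0 < lam by lra.
have mlE : m * (m + 2 * lam) + lam ^+ 2 = (m + lam) ^+ 2 by ring.
have v2 : lam ^+ 2 <= (m + lam) ^+ 2 * (1 - t ^+ 2).
  have : (m + lam) ^+ 2 * t ^+ 2 <= (m + lam) ^+ 2 * t1 ^+ 2.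
    by rewrite ler_wpM2l ?sqr_ge0// ler_pXn2r ?nnegrE// (le_trans t0).
  by rewrite t1sq mulrBr mulr1 -mlE; move: (_ * t ^+ 2) => u; lra.
have tsq : t ^+ 2 <= 1 by rewrite expr_le1// (le_trans tt1)// ltW.
have v0 : 0 < 1 - t ^+ 2.
  by rewrite -(pmulr_rgt0 _ (exprn_gt0 2 ml0)) (lt_le_trans _ v2)// exprn_gt0.
have K_ge : lam <= (m + lam) ^+ 2 * (1 - t ^+ 2) - lam * (lam - 1) by lra.
have := @energy_decay _ y lam (m * (m + 2 * lam)) N t lamN N4 (gegenbauer_ode lam q) t0.
rewrite mlE => /(_ _ v0 (ltW M0)) dec; have {}dec := dec ltac:(lra).
have eE := energyE y lam (m * (m + 2 * lam)) t.
have e0 := energyE y lam (m * (m + 2 * lam)) 0.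
(* As y is even, y'(0) = 0 and the energy at 0 is a multiple of y(0)^2. *)
rewrite mlE gegenbauer_deriv_at0 in e0; rewrite mlE in eE.
move: (energy _ _ _) dec eE e0 => e dec eE e0.
have {}e0 : e.[0] = ((m + lam) ^+ 2 - lam * (lam - 1)) * y.[0] ^+ 2.
  by rewrite e0; move: (y.[0]) => u; ring.
have vz : 1 <= (1 - t ^+ 2) * z ^+ 2.
  rewrite -(ler_pM2l (exprn_gt0 2 l0)) mulr1 mulrCA -exprMn -ml mulrC//.
have e_ge0 : 0 <= e.[t].
  by rewrite eE addr_ge0 ?sqr_ge0// mulr_ge0 ?sqr_ge0//; lra.
pose T := z ^+ N * y.[0] ^+ 2.
have T0 : 0 <= T by rewrite mulr_ge0 ?sqr_ge0// exprn_ge0//; lra.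
have e0_le : 0 <= e.[0] <= (m + lam) ^+ 2 * y.[0] ^+ 2.
  rewrite e0 mulr_ge0 ?sqr_ge0 ?ler_wpM2r ?sqr_ge0//; nra.
have e_le : e.[t] <= lam ^+ 2 * T.
  have -> : lam ^+ 2 * T = z ^+ (N - 2) * ((m + lam) ^+ 2 * y.[0] ^+ 2).
    have zN : z ^+ N = z ^+ (N - 2) * z ^+ 2 by rewrite -exprD subnK// (leq_trans _ N4).
    by rewrite /T ml zN; ring.
  have z0 : 0 <= z ^+ (N - 2) by rewrite exprn_ge0//; lra.
  rewrite -(@ler_pXn2r _ 2) ?nnegrE//; last by rewrite mulr_ge0// mulr_ge0 ?sqr_ge0.
  rewrite (@le_trans _ _ (z ^+ (N - 2) ^+ 2 * ((1 - t ^+ 2) ^+ (N - 2) * e.[t] ^+ 2)))//.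
    rewrite mulrA ler_peMl ?sqr_ge0// exprAC -exprMn mulrC exprn_ege1//.
  rewrite (exprMn 2 (z ^+ (N - 2))) ler_wpM2l ?sqr_ge0// (le_trans dec)// ler_pXn2r ?nnegrE//;
    by case/andP: e0_le => // /le_trans; apply.
have y_le : y.[t] ^+ 2 <= lam * T.
  rewrite -(ler_pM2l l0) (_ : lam * (lam * T) = lam ^+ 2 * T); last by ring.
  rewrite (le_trans _ e_le)// eE ler_wpDl ?sqr_ge0//.
  by rewrite ler_wpM2r ?sqr_ge0.
have A_le : ((1 - t ^+ 2) * y^`().[t] - lam * (t * y.[t])) ^+ 2 <= lam ^+ 2 * T.
  by rewrite (le_trans _ e_le)// eE lerDl mulr_ge0 ?sqr_ge0//; lra.
have vd_le : ((1 - t ^+ 2) * y^`().[t]) ^+ 2 <= 4 * lam ^+ 3 * T.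
  have h1 : t ^+ 2 * y.[t] ^+ 2 <= lam * T.
    by rewrite (le_trans _ y_le)// ler_piMl ?sqr_ge0.
  have h2 : lam ^+ 2 * (t ^+ 2 * y.[t] ^+ 2) <= lam ^+ 2 * (lam * T).
    by rewrite ler_wpM2l ?sqr_ge0.
  have h3 : lam ^+ 2 * T <= lam ^+ 3 * T.
    by rewrite ler_wpM2r// exprS ler_peMl ?sqr_ge0//; lra.
  move: A_le; set u := (1 - _) * _; move: h2 => h2 h4.
  have : u ^+ 2 <= 2 * (u - lam * (t * y.[t])) ^+ 2 + 2 * (lam ^+ 2 * (t ^+ 2 * y.[t] ^+ 2)).
    rewrite -subr_ge0.
    have -> : 2 * (u - lam * (t * y.[t])) ^+ 2 + 2 * (lam ^+ 2 * (t ^+ 2 * y.[t] ^+ 2)) - u ^+ 2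
      = (u - 2 * lam * t * y.[t]) ^+ 2 by ring.
    exact: sqr_ge0.
  lra.
(* The factor z^4 pays for the division by (1 - t^2)^2. *)
have d_le : y^`().[t] ^+ 2 <= 4 * lam ^+ 3 * z ^+ 4 * T.
  have vz2 : 1 <= ((1 - t ^+ 2) * z ^+ 2) ^+ 2 by rewrite exprn_ege1.
  rewrite (@le_trans _ _ (((1 - t ^+ 2) * z ^+ 2) ^+ 2 * y^`().[t] ^+ 2))//.
    by rewrite ler_peMl ?sqr_ge0.
  have -> : ((1 - t ^+ 2) * z ^+ 2) ^+ 2 * y^`().[t] ^+ 2 =
      z ^+ 4 * ((1 - t ^+ 2) * y^`().[t]) ^+ 2 by ring.
  have -> : 4 * lam ^+ 3 * z ^+ 4 * T = z ^+ 4 * (4 * lam ^+ 3 * T) by ring.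
  by rewrite ler_wpM2l// exprn_ge0//; lra.
have mB : 0 <= m + B <= 2 * lam * z ^+ 2.
  have := m2; have := B_ge0; have := B_le; move: ml; nra.
have yB_le : (m + B) ^+ 2 * y.[t] ^+ 2 <= 4 * lam ^+ 3 * z ^+ 4 * T.
  have -> : 4 * lam ^+ 3 * z ^+ 4 * T = (2 * lam * z ^+ 2) ^+ 2 * (lam * T) by ring.
  apply: ler_pM; rewrite ?sqr_ge0//; case/andP: mB => mB0 mB1.
  by rewrite ler_pXn2r ?nnegrE// (le_trans mB0).
have td_le : t ^+ 2 * y^`().[t] ^+ 2 <= 4 * lam ^+ 3 * z ^+ 4 * T.
  by rewrite (le_trans _ d_le)// ler_piMl ?sqr_ge0.
have -> : 16 * lam ^+ 3 * z ^+ (N + 4) * y.[0] ^+ 2 =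
  2 * (4 * lam ^+ 3 * z ^+ 4 * T) + 2 * (4 * lam ^+ 3 * z ^+ 4 * T).
  by rewrite /T exprD; ring.
apply: (@le_trans _ _ (2 * (t ^+ 2 * y^`().[t] ^+ 2) + 2 * ((m + B) ^+ 2 * y.[t] ^+ 2))).
  rewrite -subr_ge0.
  have -> : 2 * (t ^+ 2 * y^`().[t] ^+ 2) + 2 * ((m + B) ^+ 2 * y.[t] ^+ 2) -
    (t * y^`().[t] - (m + B) * y.[t]) ^+ 2 = (t * y^`().[t] + (m + B) * y.[t]) ^+ 2 by ring.
  exact: sqr_ge0.
lra.
Qed.

(** On [t1, 1], y' <= B y makes the left side nonpositive; on [0, t1] it is the quantity squared in
    [near0]. Both polynomials are even, which settles t < 0. *)
Lemma gegenker_bound : exists2 b : R, 0 <= b & forall t, -1 <= t <= 1 ->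
  (gegenker lam q).[t] - b * (gegenbauer lam q).[t] <=
  Num.sqrt (16 * lam ^+ 3 * z ^+ (N + 4) * (gegenbauer lam q).[0] ^+ 2).
Proof.
exists B => //.
have kE t : (gegenker lam q).[t] = t * y^`().[t] - m * y.[t].
  by rewrite /gegenker hornerD hornerN hornerM hornerZ hornerX.
have pos t : 0 <= t <= 1 -> (gegenker lam q).[t] - B * y.[t] <=
  Num.sqrt (16 * lam ^+ 3 * z ^+ (N + 4) * y.[0] ^+ 2).
  move=> /andP[t0 t_le].
  have -> : (gegenker lam q).[t] - B * y.[t] = t * y^`().[t] - (m + B) * y.[t].
    by rewrite kE; ring.
  have [tt1|/ltW tt1] := leP t t1.
    rewrite (le_trans (ler_norm _))// -sqrtr_sqr ler_wsqrtr// near0// t0//.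
  rewrite (le_trans _ (sqrtr_ge0 _))//.
  have [|yt dt] := near1 (t := t); first by rewrite tt1.
  have h1 : t * y^`().[t] <= t * (B * y.[t]) by rewrite ler_wpM2l// ltW.
  have h2 : t * (B * y.[t]) <= B * y.[t] by rewrite ler_piMl// mulr_ge0// ltW.
  have h3 : 0 <= m * y.[t] by rewrite mulr_ge0 ?ler0n// ltW.
  by rewrite subr_le0 mulrDl (le_trans h1)// (le_trans h2)// lerDr.
move=> t /andP[tl tr]; have [t0|t0] := leP 0 t; first by rewrite pos// t0.
have yN : y.[t] = y.[- t].
  rewrite -[in LHS](@comp_polyN_even _ y); last by move=> j; exact: coef_gegenbauer_odd.
  by rewrite horner_comp hornerN hornerX.
have kN : (gegenker lam q).[t] = (gegenker lam q).[- t].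
  rewrite -[in LHS](@comp_polyN_even _ (gegenker lam q)); last first.
    by move=> j oj; rewrite coef_gegenker coef_gegenbauer_odd ?mulr0.
  by rewrite horner_comp hornerN hornerX.
by rewrite -/y yN kN pos//; lra.
Qed.
End GegenbauerBound.

(** * Orthogonality and the dual functional *)

Definition jacobi_int {R : realType} (n : nat) (p : {poly R}) : R :=
  \int[lebesgue_measure]_(t in `]-1, 1[) (p.[t] * jacobi_weight n t).

(** * Integration against the weight *)

Section JacobiInt.
Context {R : realType} (n : nat) (n3 : (3 <= n)%N).
Implicit Types (p q : {poly R}).
Notation mu := (@lebesgue_measure R).
Notation L := (@jacobi_int R n).

Lemma jacobi_intD p q : L (p + q) = L p + L q.
Proof.
rewrite /jacobi_int -RintegralD//; try exact: jacobi_weight_integrable.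
by apply: eq_Rintegral => t _; rewrite hornerD mulrDl.
Qed.

Lemma jacobi_intZ c p : L (c *: p) = c * L p.
Proof.
rewrite /jacobi_int -RintegralZl//; try exact: jacobi_weight_integrable.
by apply: eq_Rintegral => t _; rewrite hornerZ mulrA.
Qed.

Lemma jacobi_intN p : L (- p) = - L p.
Proof. by rewrite -scaleN1r jacobi_intZ mulN1r. Qed.

Lemma jacobi_intB p q : L (p - q) = L p - L q.
Proof. by rewrite jacobi_intD jacobi_intN. Qed.

Lemma jacobi_int0 : L 0 = 0.
Proof. by rewrite -(subrr 0) jacobi_intB subrr. Qed.

Lemma jacobi_int_sum I (r : seq I) (P : pred I) (F : I -> {poly R}) :
  L (\sum_(i <- r | P i) F i) = \sum_(i <- r | P i) L (F i).
Proof. by apply: (big_morph L jacobi_intD); exact: jacobi_int0. Qed.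

Lemma jacobi_int_ge0 p : (forall t, -1 <= t <= 1 -> 0 <= p.[t]) -> 0 <= L p.
Proof.
move=> p0; apply: Rintegral_ge0 => t tI.
have /andP[/ltW w0 _] := jacobi_weight_itv n3 tI.
rewrite mulr_ge0// p0//; move: tI; rewrite /= in_itv/= => /andP[a b].
by rewrite !ltW.
Qed.

(** A zero integral would make the integrand vanish almost everywhere on (-1, 1), but the weight is
    positive there and p has finitely many roots. *)
Lemma jacobi_int_gt0 p : p != 0 -> (forall t, -1 <= t <= 1 -> 0 <= p.[t]) ->
  0 < L p.
Proof.
move=> p0 pge0; rewrite lt0r jacobi_int_ge0// andbT; apply/eqP => Lp.
pose I : set R := `]-1, 1[%classic.
have mI : measurable I by exact: measurable_itv.
have ip := jacobi_weight_integrable n3 p.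
have ge0 (t : R) : t \in I -> 0 <= p.[t] * jacobi_weight n t.
  rewrite inE => tI; have /andP[/ltW w0 _] := jacobi_weight_itv n3 tI.
  rewrite mulr_ge0// pge0//; move: tI; rewrite /I /= in_itv/= => /andP[a b].
  by rewrite !ltW.
have : (\int[mu]_(t in I) `|(p.[t] * jacobi_weight n t)%:E| = 0)%E.
  under eq_integral => t tI do rewrite gee0_abs ?lee_fin ?ge0//.
  rewrite -[LHS]fineK; first by congr EFin.
  exact: integrable_fin_num.
have mf : measurable_fun I (fun t : R => (p.[t] * jacobi_weight n t)%:E).
  by have /integrableP[] := ip.
move=> /(ae_eq_integral_abs mu mI mf) [N [mN N0 subN]].
have Z0 : mu [set t | root p t] = 0%E.
  apply: countable_lebesgue_measure0; apply: finite_set_countable.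
  apply: contrapT => /(@infinite_set_fset _ _ (size p))[B BZ sB].
  move/eqP: p0; apply; apply: (@roots_geq_poly_eq0 _ _ (finmap.enum_fset B)) => //.
    by apply/allP => t; exact: BZ.
  exact: finmap.fset_uniq.
have mZ : measurable [set t : R | root p t].
  rewrite (_ : [set t | _] = (horner p) @^-1` [set 0]); last first.
    by apply/seteqP; split=> t /eqP.
  rewrite -[_ @^-1` _]setTI.
  apply: (@continuous_measurable_fun _ (horner p)) => //.
  exact: continuous_horner.
have : (mu I <= mu (N `|` [set t | root p t]))%E.
  apply: le_measure; rewrite ?inE//; first exact: measurableU.
  move=> t It; have [|rt] := boolP (root p t); [by right|left].
  apply: subN => /= /(_ It)[] /eqP; rewrite mulf_eq0 -[_ == 0]/(root p t).
  by rewrite (negPf rt) gt_eqF//; have /andP[] := jacobi_weight_itv n3 It.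
rewrite measureU0// N0 lebesgue_measure_itv/= lte_fin (lt_trans (ltrN10 R) ltr01).
by rewrite -EFinB lee_fin => h; exfalso; lra.
Qed.

Lemma jacobi_int_sqr_eq0 p : L (p * p) = 0 -> p = 0.
Proof.
move=> Lp; apply/eqP; apply: contraTT isT => p0.
suff : 0 < L (p * p) by rewrite Lp ltxx.
apply: jacobi_int_gt0; first by rewrite mulf_neq0.
by move=> t _; rewrite hornerM -expr2 sqr_ge0.
Qed.

Lemma jacobi_int1_gt0 : 0 < L 1.
Proof. by apply: jacobi_int_gt0 => [|t _]; rewrite ?oner_eq0// hornerC. Qed.

(** The exponent (n - 3) / 2 may be a half-integer; a natural power of a square root is continuous
    up to the endpoints and simple to differentiate. *)
Lemma jacobi_weight_sqrt (t : R) : `]-1, 1[%classic t ->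
  jacobi_weight n t = Num.sqrt (1 - t ^+ 2) ^+ (n - 3).
Proof.
rewrite /= in_itv/= => /andP[t1 t2].
have t3 : 0 <= 1 - t ^+ 2 by nra.
rewrite /jacobi_weight /jacobi_param -natrB// mulrC powRrM powR12_sqrt//.
by rewrite powR_mulrn// sqrtr_ge0.
Qed.

(** Integration by parts: p (1 - t^2)^((n - 1) / 2) vanishes at both endpoints, and its derivative
    is the difference of the two integrands. *)
Lemma jacobi_int_pearson p :
  L ((1 - 'X^2) * p^`()) = (n%:R - 1) * L ('X * p).
Proof.
apply/eqP; rewrite -subr_eq0 -jacobi_intZ -jacobi_intB; apply/eqP.
set g := (_ - _ : {poly R}).
pose s (t : R) := Num.sqrt (1 - t ^+ 2).
pose F (t : R) := p.[t] * s t ^+ (n - 1).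
pose f (t : R) := g.[t] * s t ^+ (n - 3).
have cs : continuous s.
  move=> x; apply: (@continuous_comp _ _ _ (fun t : R => 1 - t ^+ 2) Num.sqrt); last exact: sqrt_continuous.
  by apply: continuousB; [exact: cst_continuous|exact: exprn_continuous].
have csX k : continuous (fun t => s t ^+ k).
  by move=> x; apply: (@continuous_comp _ _ _ s (fun u : R => u ^+ k)); [exact: cs|exact: exprn_continuous].
have cf : continuous f.
  by move=> x; apply: continuousM; [exact: continuous_horner|exact: csX].
have cF : continuous F.
  by move=> x; apply: continuousM; [exact: continuous_horner|exact: csX].
(* The square root is not differentiable at 0, so derivatives are taken on the open interval; at -1
   and 1 the fundamental theorem uses the continuity of [F]. *)
have dF (t : R) : t \in `]-1, 1[ -> is_derive t 1 F (f t).
  rewrite in_itv/= => /andP[t1 t2].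
  have t3 : 0 < 1 - t ^+ 2 by nra.
  have ds : is_derive t 1 s ((2 * s t)^-1 * (- (2 * t))).
    have h1 : is_derive t 1 (fun t : R => 1 - t ^+ 2) (- (2 * t)).
      have -> : (fun t : R => 1 - t ^+ 2) = horner (1 - 'X^2).
        by apply/funext => u; rewrite !hornerE.
      apply: is_derive_eq; rewrite derivB derivXn derivC !hornerE /=; lra.
    have h2 := is_derive1_sqrt t3.
    exact: (@is_derive1_comp _ Num.sqrt (fun t : R => 1 - t ^+ 2) _ _ _ h2 h1).
  have -> : F = horner p * s ^+ (n - 1).
    by apply/funext => u; rewrite fctE exprfctE.
  rewrite /f; apply: is_derive_eq.
  have s0 : 0 < s t by rewrite sqrtr_gt0.
  have s2 : s t ^+ 2 = 1 - t ^+ 2 by rewrite sqr_sqrtr// ltW.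
  have -> : (n - 1 = (n - 3).+2)%N by lia.
  rewrite exprfctE /g /GRing.scale/= !hornerE -s2 !exprS expr0 mulr1 /=.
  have -> : n%:R = (n - 3)%:R + 3 :> R by rewrite -natrD subnK.
  rewrite -(natr1 (n - 3).+1) -(natr1 (n - 3)); field; lra.
have LE : L g = \int[mu]_(t in `[-1, 1]) f t.
  transitivity (\int[mu]_(t in `]-1, 1[) f t).
    by apply: eq_Rintegral => t; rewrite inE => tI; rewrite jacobi_weight_sqrt.
  have If : mu.-integrable `[-1, 1] (EFin \o f).
    apply: continuous_compact_integrable; first exact: segment_compact.
    exact: continuous_subspaceT.
  rewrite Rintegral_itv_bndo_bndc.
    rewrite Rintegral_itv_obnd_cbnd//; apply: integrableS If => //.
    exact: subset_itv_oc_cc.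
  apply: integrableS If => //; exact: subset_itv_oo_cc.
rewrite LE /Rintegral (@continuous_FTC2 _ f F (-1) 1); first last.
- by move=> t tI; rewrite derive1E; have [_] := dF t tI.
- split; [by move=> t /dF[]| |].
    by apply: cvg_at_right_filter; exact: cF.
  by apply: cvg_at_left_filter; exact: cF.
- exact: continuous_subspaceT.
- by rewrite (lt_trans (ltrN10 R) ltr01).
have n1 : (n - 1 != 0)%N by lia.
by rewrite /F /s sqrrN expr1n subrr sqrtr0 expr0n (negPf n1) !mulr0 subee.
Qed.

End JacobiInt.

(** * Gegenbauer polynomials as orthogonal polynomials *)

Section Orthogonality.
Context {R : realType} (n : nat) (n3 : (3 <= n)%N).
Implicit Types (p r : {poly R}).
Notation L := (@jacobi_int R n).
Let lam : R := (n%:R - 2) / 2.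
Let y q := gegenbauer lam q.
Let n_lam : n%:R - 1 = 2 * lam + 1.
Proof. rewrite /lam; lra. Qed.
Let lam_gt0 : 0 < lam.
Proof. have : 3 <= n%:R :> R by rewrite (ler_nat _ 3). rewrite /lam; lra. Qed.

(** This is [jacobi_int_pearson] for p' r. The right side is symmetric in p and r, whence the
    self-adjointness below. *)
Lemma jacobi_int_deriv p r :
  L (((1 - 'X^2) * p^`()^`() - (n%:R - 1) *: ('X * p^`())) * r) =
  - L ((1 - 'X^2) * (p^`() * r^`())).
Proof.
have := jacobi_int_pearson n3 (p^`() * r).
rewrite derivM mulrDr jacobi_intD// => /eqP.
rewrite -subr_eq0 -jacobi_intZ// => h.
rewrite mulrBl -scalerAl jacobi_intB// -!mulrA; apply/eqP.
by rewrite -addr_eq0 addrAC.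
Qed.

Lemma jacobi_int_selfadj p r :
  L (((1 - 'X^2) * p^`()^`() - (n%:R - 1) *: ('X * p^`())) * r) =
  L (p * ((1 - 'X^2) * r^`()^`() - (n%:R - 1) *: ('X * r^`()))).
Proof. by rewrite jacobi_int_deriv [in RHS]mulrC jacobi_int_deriv [r^`() * _]mulrC. Qed.

Lemma jacobi_int_odd i : L 'X^(i.*2.+1) = 0.
Proof.
have n10 : 0 < n%:R - 1 :> R by rewrite n_lam; have := lam_gt0; lra.
elim: i => [|i IH].
  have := @jacobi_int_pearson R n n3 1.
  rewrite derivC mulr0 jacobi_int0// mulr1 => /esym/eqP.
  by rewrite mulf_eq0 gt_eqF//= => /eqP.
have := @jacobi_int_pearson R n n3 'X^(i.*2.+2).
rewrite derivXn/= -scaler_nat -scalerAr mulrBl mul1r -exprD jacobi_intZ// jacobi_intB//.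
rewrite -exprS IH sub0r mulrN => /esym/eqP; rewrite -addr_eq0 -doubleS add2n -mulrDl.
by rewrite mulf_eq0 gt_eqF 1?ltr_wpDr//= => /eqP.
Qed.

Lemma jacobi_int_compN p : L (p \Po - 'X) = L p.
Proof.
rewrite comp_polyE jacobi_int_sum// -[in RHS](coefK p) poly_def jacobi_int_sum//.
apply: eq_bigr => j _; rewrite exprNn -signr_odd !jacobi_intZ//.
have [oj|_] := boolP (odd j); last by rewrite mul1r.
by rewrite expr1 mulN1r jacobi_intN// -[nat_of_ord j]odd_double_half oj jacobi_int_odd oppr0.
Qed.

(** Under the self-adjoint Gegenbauer operator y is an eigenvector, and X^j is one up to a multiple
    of X^(j - 2), which the induction handles. The eigenvalues - m (m + 2 lam), with m = 2q, and - j
    (j + 2 lam) differ because j < m. *)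
Lemma jacobi_int_gegenbauerXn q j : (j < q.*2)%N -> L (y q * 'X^j) = 0.
Proof.
have [M] := ubnP j; elim: M j => // M IH j; rewrite ltnS => jM jq.
(* For j <= 1 the subtraction j - 2 is truncated to 0; the side condition then forces c = 0. *)
have opXn : exists2 c, (1 < j)%N || (c == 0) &
    (1 - 'X^2) * ('X^j)^`()^`() - (n%:R - 1) *: ('X * ('X^j)^`())
    = c *: 'X^(j - 2) - (j%:R * (j%:R + 2 * lam)) *: 'X^j :> {poly R}.
  rewrite n_lam; case: j {jM jq} => [|[|j]].
  - by exists 0; rewrite ?eqxx// expr0 derivC deriv0 !mulr0 scaler0 mul0r !scale0r.
  - exists 0; rewrite ?eqxx//.
    have -> : 1%:R * (1%:R + 2 * lam) = 2 * lam + 1 by ring.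
    by rewrite expr1 derivX derivC mulr0 scale0r mulr1.
  exists (j.+2%:R * j.+1%:R) => //.
  have dX i : ('X^(i.+1))^`() = i.+1%:R *: ('X^i : {poly R}) by rewrite derivXn scaler_nat.
  rewrite subn2/= !dX derivZ dX -!scalerAr scalerA /=.
  rewrite mulrBl mul1r -exprD -exprS scalerBr scalerA -addrA -opprD -scalerDl.
  rewrite -!(natr1 j.+1) -!(natr1 j).
  congr (_ - _); congr (_ *: _); ring.
have := jacobi_int_selfadj (y q) 'X^j.
have -> : (1 - 'X^2) * (y q)^`()^`() - (n%:R - 1) *: ('X * (y q)^`()) =
    - (q.*2%:R * (q.*2%:R + 2 * lam)) *: y q.
  by apply/eqP; rewrite scaleNr -addr_eq0 n_lam gegenbauer_ode.
have [c cj ->] := opXn.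
have c0 : c * L (y q * 'X^(j - 2)) = 0.
  case/orP: cj => [j1|/eqP->]; last by rewrite mul0r.
  by rewrite IH ?mulr0//; lia.
rewrite mulrBr -!(scalerAr _ (y q)) -scalerAl jacobi_intB// !jacobi_intZ// c0 => /eqP.
rewrite sub0r -subr_eq0 opprK -mulrDl mulf_eq0 => /orP[|/eqP//].
have jq' : j%:R < q.*2%:R :> R by rewrite ltr_nat.
have j0 : 0 <= j%:R :> R by exact: ler0n.
have lt (u v l : R) : v < u -> 0 <= v -> 0 < l -> v * (v + 2 * l) < u * (u + 2 * l).
  by move=> vu v0 l0; nra.
by move=> /eqP h; have := lt _ _ _ jq' j0 lam_gt0; lra.
Qed.

Lemma jacobi_int_gegenbauer q p : (size p <= q.*2)%N -> L (y q * p) = 0.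
Proof.
move=> sp; rewrite -(coefK p) poly_def mulr_sumr jacobi_int_sum// big1// => j _.
by rewrite -scalerAr jacobi_intZ// jacobi_int_gegenbauerXn ?mulr0// (leq_trans (ltn_ord j)).
Qed.

Let ker q := gegenker lam q.

Lemma gegenker_even q : ker q \Po - 'X = ker q.
Proof.
apply: comp_polyN_even => j oj.
by rewrite coef_gegenker coef_gegenbauer_odd// mulr0.
Qed.

(** Telescoping [gegenkerS] leaves the constant 2 lam from degree 0; every later increment is
    orthogonal to 1. *)
Lemma jacobi_int_gegenker q : (0 < q)%N -> L (ker q) = 2 * lam * L 1.
Proof.
case: q => // q _; elim: q => [|q IH]; rewrite /ker gegenkerS jacobi_intD// jacobi_intZ//.
  rewrite /gegenker gegenbauer0 derivC mulr0 double0 scale0r subr0 jacobi_int0//.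
  by rewrite add0r mulr0 addr0.
rewrite IH -[gegenbauer _ _]mulr1 (@jacobi_int_gegenbauer q.+1 1) ?mulr0 ?addr0//.
by rewrite size_poly1 doubleS.
Qed.

Lemma jacobi_int_gegenkerX q : L ('X * ker q) = 0.
Proof.
have : L ('X * ker q) = - L ('X * ker q).
  by rewrite -[LHS]jacobi_int_compN comp_polyM comp_polyX gegenker_even mulNr jacobi_intN.
lra.
Qed.

(** Write p = r (X^2 - 1) + e with e affine. The first part vanishes at 1 and -1 and is orthogonal
    to psi; for e, the integrals of psi and X psi suffice. *)
Lemma jacobi_int_gegenker_repr q p : (0 < q)%N -> (size p <= q.*2)%N ->
  L (p * ker q) = lam * (p.[1] + p.[-1]) * L 1.
Proof.
move=> q0 sp.
pose D : {poly R} := 'X^2 - 1.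
have mD : D \is monic.
  by rewrite monicE lead_coefDl ?lead_coefXn// size_polyXn size_polyN size_poly1.
have sD : size D = 3.
  by rewrite size_polyDl ?size_polyXn// size_polyN size_poly1.
have D0 : D != 0 by rewrite monic_neq0.
pose r := p %/ D; pose e := p %% D.
have pE : p = r * D + e by exact: divp_eq.
have se : (size e <= 2)%N by have := ltn_modp p D; rewrite D0 sD.
have sr : ((size r).+2 <= q.*2)%N.
  have : (size r <= q.*2 - 2)%N by rewrite size_divp// sD leq_sub2r.
  by move: (size r) => u; lia.
have eE : e = e`_0 *: 1 + e`_1 *: 'X.
  apply/polyP => i; rewrite coefD !coefZ coef1 coefX.
  by case: i => [|[|i]]; rewrite ?mulr1 ?mulr0 ?addr0 ?add0r// nth_default// (leq_trans se).
have rD : L (r * D * ker q) = 0.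
  rewrite /ker /gegenker mulrBr -scalerAr jacobi_intB// jacobi_intZ//.
  have sz (k : {poly R}) : (size (D * k)%R <= (size k).+2)%N.
    by rewrite (leq_trans (size_polyMleq _ _))// sD.
  rewrite [X in _ - _ * L X]mulrC jacobi_int_gegenbauer ?mulr0 ?subr0; last first.
    by rewrite mulrC (leq_trans (sz _)).
  (* Integration by parts moves the derivative off y; what remains is y times polynomials of degree
     below 2q. *)
  have := @jacobi_int_pearson R n n3 ('X * r * y q).
  rewrite derivM mulrDr jacobi_intD//.
  have -> : (1 - 'X^2) * (('X * r)^`() * y q) = - (y q * (D * ('X * r)^`())).
    by rewrite /D; ring.
  have -> : 'X * ('X * r * y q) = y q * ('X * ('X * r)) by ring.
  have -> : (1 - 'X^2) * ('X * r * (y q)^`()) = - (r * D * ('X * (y q)^`())).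
    by rewrite /D; ring.
  have sX (k : {poly R}) : (size ('X * k)%R <= (size k).+1)%N.
    by rewrite (leq_trans (size_polyMleq _ _))// size_polyX.
  rewrite !jacobi_intN// jacobi_int_gegenbauer; last first.
    rewrite (leq_trans (sz _))// (leq_trans _ sr)// !ltnS.
    have : (size ('X * r)%R^`() <= size r)%N.
      by apply/leq_sizeP => i ri; rewrite coef_deriv nth_default ?mul0rn// (leq_trans (sX r)).
    exact.
  rewrite jacobi_int_gegenbauer; last first.
    by rewrite (leq_trans (sX _))// (leq_trans _ sr)// ltnS sX.
  by rewrite mulr0 oppr0 add0r => /eqP; rewrite oppr_eq0 => /eqP.
have D1 : D.[1] = 0 by rewrite /D !hornerE /=; ring.
have DN1 : D.[-1] = 0 by rewrite /D !hornerE /=; ring.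
rewrite pE mulrDl jacobi_intD// rD add0r (hornerD _ _ 1) (hornerD _ _ (-1)) (hornerM _ _ 1) (hornerM _ _ (-1)) D1 DN1 !mulr0 !add0r eE.
move: (e`_0) (e`_1) => a b; rewrite mulrDl -!(scalerAl _ _ (ker q)) jacobi_intD// !jacobi_intZ// mul1r.
have ev c : (a *: 1 + b *: 'X).[c] = a + b * c by rewrite !hornerE.
rewrite jacobi_int_gegenker// jacobi_int_gegenkerX !ev; ring.
Qed.

End Orthogonality.

(** * The Jacobi family and linear programming duality *)

Section JacobiFamily.
Context {R : realType} (n : nat) (n3 : (3 <= n)%N).
Implicit Types (p r : {poly R}).
Notation L := (@jacobi_int R n).
Notation P := (@jacobi R n).
Let lam : R := (n%:R - 2) / 2.
Let lam_gt0 : 0 < lam.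
Proof. have : 3 <= n%:R :> R by rewrite (ler_nat _ 3). rewrite /lam; lra. Qed.

Lemma size_jacobi s : size (P s) = s.+1.
Proof. by have [] := @jacobiP R n n3. Qed.

Lemma jacobi_at1_gt0 s : 0 < (P s).[1].
Proof. by have [_ _ ->] := @jacobiP R n n3; exact: gbinom_jacobi_gt0. Qed.

Lemma jacobi0 : P 0 = 1.
Proof.
have /size1_polyC PC : (size (P 0) <= 1)%N by rewrite size_jacobi.
have [_ _ /(_ 0%N)] := @jacobiP R n n3.
by rewrite PC hornerC /gbinom big_ord0 fact0 divr1 => ->.
Qed.

Lemma jacobi_orth s p : (size p <= s)%N -> L (P s * p) = 0.
Proof.
have [M] := ubnP (size p); elim: M p => // M IH p; rewrite ltnS => pM ps.
have [->|p0] := eqVneq p 0; first by rewrite mulr0 jacobi_int0.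
pose j := (size p).-1.
have jE : size p = j.+1 by rewrite /j prednK// size_poly_gt0.
have js : (j < s)%N by rewrite -jE.
have Pj0 : (P j)`_j != 0.
  have -> : (P j)`_j = lead_coef (P j) by rewrite lead_coefE size_jacobi.
  by rewrite lead_coef_eq0 -size_poly_eq0 size_jacobi.
pose c := p`_j / (P j)`_j.
have sq : (size (p - c *: P j)%R <= j)%N.
  apply/leq_sizeP => i; rewrite leq_eqVlt => /predU1P[<-|ji].
    by rewrite coefB coefZ /c divfK// subrr.
  by rewrite coefB coefZ !nth_default ?mulr0 ?subr0// ?size_jacobi ?jE.
rewrite -[p](subrK (c *: P j)) mulrDr jacobi_intD// IH ?add0r; first last.
- by rewrite (leq_trans sq)// ltnW.
- by rewrite (leq_ltn_trans sq)// -jE.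
rewrite -scalerAr jacobi_intZ//; have [_ orth _] := @jacobiP R n n3.
have -> : L (P s * P j) = 0; last by rewrite mulr0.
rewrite -[RHS](orth s j); last by rewrite gtn_eqF.
by apply: eq_Rintegral => t _; rewrite hornerM.
Qed.

Lemma jacobi_unique s p : (size p <= s.+1)%N ->
  (forall r, (size r <= s)%N -> L (p * r) = 0) -> exists c, p = c *: P s.
Proof.
move=> sp orth; pose c := p`_s / (P s)`_s; exists c; apply/eqP; rewrite -subr_eq0.
have Ps0 : (P s)`_s != 0.
  have -> : (P s)`_s = lead_coef (P s) by rewrite lead_coefE size_jacobi.
  by rewrite lead_coef_eq0 -size_poly_eq0 size_jacobi.
apply/eqP; apply: (jacobi_int_sqr_eq0 n3).
have sq : (size (p - c *: P s)%R <= s)%N.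
  apply/leq_sizeP => i; rewrite leq_eqVlt => /predU1P[<-|si].
    by rewrite coefB coefZ /c divfK// subrr.
  by rewrite coefB coefZ !nth_default ?mulr0 ?subr0// ?size_jacobi// (leq_trans sp).
rewrite [X in L (X * _)]/GRing.add/= mulrBl jacobi_intB// orth// -scalerAl.
by rewrite jacobi_intZ// jacobi_orth// mulr0 subrr.
Qed.

(** By uniqueness P_s(-X) = c P_s(X), and reflecting twice gives c^2 = 1. So P_s(-1) is P_s(1) or
    its opposite. *)
Lemma jacobi_atN1 s : 0 <= (P s).[1] + (P s).[-1].
Proof.
have XX : (- 'X : {poly R}) \Po - 'X = 'X by rewrite rmorphN/= comp_polyX opprK.
have [c Pc] : exists c, P s \Po - 'X = c *: P s.
  apply: jacobi_unique => [|r rs].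
    by rewrite size_comp_poly2 ?size_jacobi// size_polyN size_polyX.
  rewrite -(jacobi_int_compN n3) comp_polyM -comp_polyA XX comp_polyXr.
  by rewrite jacobi_orth// size_comp_poly2// size_polyN size_polyX.
have c2 : c ^+ 2 = 1.
  have : P s = c ^+ 2 *: P s.
    by rewrite expr2 -scalerA -Pc -comp_polyZ -Pc -comp_polyA XX comp_polyXr.
  move/(congr1 (horner^~ 1)); rewrite hornerZ => /eqP.
  rewrite -{1}[(P s).[1]]mul1r -subr_eq0 -mulrBl mulf_eq0.
  by rewrite (gt_eqF (jacobi_at1_gt0 s)) orbF subr_eq0 => /eqP.
have -> : (P s).[-1] = c * (P s).[1].
  by rewrite -hornerZ -Pc horner_comp hornerN hornerX.
have := jacobi_at1_gt0 s; nra.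
Qed.

(** Orthogonality gives 0 for s > 2q. For s = 2q, y is a multiple of P_s, by a positive factor since
    both are positive at 1. *)
Lemma jacobi_int_gegenbauer_ge0 q s : (q.*2 <= s)%N -> 0 <= L (P s * gegenbauer lam q).
Proof.
rewrite leq_eqVlt => /predU1P[<-|qs]; last first.
  by rewrite jacobi_orth// (leq_trans (size_gegenbauer _ _)).
have [c yE] : exists c, gegenbauer lam q = c *: P q.*2.
  by apply: jacobi_unique; [exact: size_gegenbauer|exact: jacobi_int_gegenbauer].
have := gegenbauer_gt0_at1 q lam_gt0; rewrite yE hornerZ pmulr_lgt0 ?jacobi_at1_gt0// => c0.
rewrite -scalerAr jacobi_intZ// mulr_ge0 ?(ltW c0)//; apply: jacobi_int_ge0 => // t _.
by rewrite hornerM -expr2 sqr_ge0.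
Qed.

Lemma size_gegenker q : (0 < q)%N -> (size (gegenker lam q) < q.*2)%N.
Proof.
move=> q0; rewrite -(ltn_predK (_ : 0 < q.*2)%N) ?double_gt0// ltnS.
apply/leq_sizeP => j qj; rewrite coef_gegenker.
have [jq|qj'] := leqP j q.*2; last by rewrite coef_gegenbauer_big ?mulr0.
have [->|jne] := eqVneq j q.*2; first by rewrite subrr mul0r.
have -> : j = q.*2.-1 by lia.
rewrite coef_gegenbauer_odd ?mulr0//.
by move: q0; case: (q) => // q' _; rewrite doubleS /= odd_double.
Qed.

(** Weak duality with certificate [Lam]: it kills P_s for 0 < s < 2q, and from s = 2q >= k on the
    sign condition a_s <= 0 applies. *)
Lemma LP_feasible_coef0_ge k q m (a : nat -> R) (B eta : R) :
  (0 < k <= q.*2)%N -> 0 <= B -> 0 <= eta ->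
  (forall t, -1 <= t <= 1 ->
    eta * ((gegenker lam q).[t] - B * (gegenbauer lam q).[t]) <= 1) ->
  LP_feasible n k m a -> lam * eta <= a 0%N.
Proof.
move=> /andP[k0 kq] B0 eta0 G0; rewrite /LP_feasible; set F := \sum_(_ < _) _.
move=> [Fge0 F1 a_le0].
have q0 : (0 < q)%N by rewrite -double_gt0 (leq_trans k0).
have l1 := @jacobi_int1_gt0 R n n3.
pose G := 1 - eta *: (gegenker lam q - B *: gegenbauer lam q).
(* This is the functional of the header multiplied by L 1. *)
pose Lam p := lam * eta * L 1 * (p.[1] + p.[-1]) + L (p * G).
have LamE p : Lam p = lam * eta * L 1 * (p.[1] + p.[-1]) + L p
     - eta * L (p * gegenker lam q) + eta * B * L (p * gegenbauer lam q).
  rewrite /Lam /G mulrBr mulr1 -scalerAr mulrBr -scalerAr.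
  by rewrite jacobi_intB// jacobi_intZ// jacobi_intB// jacobi_intZ//; ring.
have Lam_low p : (size p <= q.*2)%N -> Lam p = L p.
  move=> sp; rewrite LamE jacobi_int_gegenker_repr// -/lam.
  by rewrite [p * gegenbauer _ _]mulrC jacobi_int_gegenbauer//; ring.
(* Both psi and 1 are orthogonal to P_s here, so only the endpoint term and the y term are left,
   both nonnegative. *)
have Lam_high s : (q.*2 <= s)%N -> 0 <= Lam (P s).
  move=> qs; have s0 : (0 < s)%N by rewrite (leq_trans _ qs)// double_gt0.
  rewrite LamE (@jacobi_orth s (gegenker lam q)); last first.
    by rewrite ltnW// (leq_trans (size_gegenker q0)).
  have -> : L (P s) = 0 by rewrite -[P s]mulr1 jacobi_orth// size_poly1.
  rewrite mulr0 subr0 addr0 addr_ge0//.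
    by apply: mulr_ge0 (jacobi_atN1 s); rewrite mulr_ge0 ?(ltW l1)// mulr_ge0// ltW.
  by rewrite !mulr_ge0// jacobi_int_gegenbauer_ge0.
have LamF : Lam F = \sum_(s < m.+1) a s * Lam (P s).
  rewrite /Lam /F !horner_sum mulr_suml jacobi_int_sum// -!big_split/= mulr_sumr -big_split/=.
  apply: eq_bigr => s _; rewrite !hornerZ -(scalerAl _ (P s) G) jacobi_intZ//; ring.
have LamF_le : Lam F <= a 0%N * L 1.
  rewrite LamF big_ord_recl/= jacobi0 Lam_low ?size_poly1 ?double_gt0//.
  rewrite gerDl sumr_le0// => i _; rewrite /bump/= add1n.
  have : (i.+1 <= m)%N by exact: ltn_ord.
  have : (0 < i.+1)%N by []; move: i.+1 => s s0 sm.
  have [sq|qs] := ltnP s q.*2.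
    rewrite Lam_low ?size_jacobi// -[P s]mulr1 jacobi_orth ?size_poly1//.
    by rewrite mulr0.
  by rewrite mulr_le0_ge0 ?Lam_high// a_le0// (leq_trans kq qs).
have LamF_ge : lam * eta * L 1 <= Lam F.
  have FN1 : 0 <= F.[-1] by apply: Fge0; lra.
  have FG : 0 <= L (F * G).
    apply: jacobi_int_ge0 => // t t1; rewrite hornerM mulr_ge0 ?Fge0//.
    by have := G0 t t1; rewrite /G !(hornerD, hornerN, hornerZ, hornerC) subr_ge0.
  rewrite /Lam F1 -[X in X <= _]addr0 lerD// -[X in X <= _]mulr1.
  by rewrite ler_wpM2l ?lerDl// mulr_ge0 ?(ltW l1)// mulr_ge0// ltW.
by have := le_trans LamF_ge LamF_le; rewrite ler_pM2r.
Qed.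

End JacobiFamily.

(** * Numerical estimates *)

Section Estimates.
Context {R : realType}.
Notation E := (expR 1 : R).

Lemma rising_addr1 (a : R) q : a != 0 -> rising (a + 1) q = rising a q * ((a + q%:R) / a).
Proof.
move=> a0; elim: q => [|q IH]; first by rewrite /rising !big_ord0 addr0 divff// mulr1.
by rewrite !risingS IH -(natr1 q); field.
Qed.

Lemma rising1 (q : nat) : rising (1 : R) q = q`!%:R.
Proof.
elim: q => [|q IH]; first by rewrite /rising big_ord0 fact0.
by rewrite risingS IH factS natrM mulrC -(natr1 q) addrC.
Qed.

(** Base case of [rising_half_le] for odd N; for even N the base is a = 1, where the quotient is
    1. *)
Lemma rising_three_halves (q : nat) : (rising (3 / 2 : R) q / q`!%:R) ^+ 2 <= 2 * q%:R + 1.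
Proof.
elim: q => [|q IH]; first by rewrite /rising big_ord0 fact0 divr1 expr1n mulr0 add0r.
rewrite risingS factS natrM.
have f0 : q`!%:R != 0 :> R by rewrite pnatr_eq0 -lt0n fact_gt0.
have q1 : 0 < q.+1%:R :> R by rewrite ltr0n.
set r := rising _ q in IH *.
have -> : r * (3 / 2 + q%:R) / (q.+1%:R * q`!%:R) = (r / q`!%:R) * ((3 / 2 + q%:R) / q.+1%:R).
  by field; rewrite f0 gt_eqF.
rewrite exprMn; apply: (@le_trans _ _ ((2 * q%:R + 1) * ((3 / 2 + q%:R) / q.+1%:R) ^+ 2)).
  by rewrite ler_wpM2r ?sqr_ge0.
rewrite exprMn exprVn mulrA ler_pdivrMr ?exprn_gt0// -(natr1 q).
have : 0 <= q%:R :> R by []; move: (q%:R) => x x0; nra.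
Qed.

Lemma expR1_ge1 : 1 <= E.
Proof. by rewrite -expR0 ler_expR. Qed.

Lemma exprn_le_expR (x : R) d : 0 <= x -> (1 + x) ^+ d <= expR (x * d%:R).
Proof.
move=> x0; rewrite mulrC expRM_natl lerXn2r ?nnegrE ?expR_ge0 ?expR_ge1Dx//.
by rewrite addr_ge0.
Qed.

(** (1 + 2 / N)^d <= exp (2 d / N) <= e^(2 c). *)
Lemma exprn_add2_le N d c : (0 < N)%N -> (d <= c * N)%N ->
  (N.+2%:R : R) ^+ d <= N%:R ^+ d * E ^+ (2 * c).
Proof.
move=> N0 dN; have N0R : 0 < N%:R :> R by rewrite ltr0n.
have -> : N.+2%:R = N%:R * (1 + 2 / N%:R) :> R.
  by rewrite -addn2 natrD mulrDr mulr1 mulrCA divff ?mulr1// gt_eqF.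
rewrite exprMn ler_pM2l ?exprn_gt0//.
rewrite (le_trans (exprn_le_expR _ _))// ?divr_ge0//.
rewrite -expRM_natl mulr1 ler_expR natrM mulrAC ler_pdivrMr//.
by rewrite -mulrA ler_pM2l// -natrM ler_nat.
Qed.

(* A_a(q) = (a)_q / q! satisfies A_(a+1)(q) = A_a(q) (a + q) / a, whence an
   induction on N with step 2. *)
Lemma rising_half_le (N q : nat) :
  (rising (N.+2%:R / 2 : R) q / q`!%:R) ^+ 2 * N.+2%:R ^+ N <=
  (q + N.+2)%:R ^+ N * (2 * E) ^+ N.+2.
Proof.
have E1 := expR1_ge1.
have [M] := ubnP N; elim: M N => // M IH [_|[_|N]].
- rewrite divff ?pnatr_eq0// rising1.
  have f0 : q`!%:R != 0 :> R by rewrite pnatr_eq0 -lt0n fact_gt0.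
  rewrite divff// expr1n !expr0 !mul1r; nra.
- rewrite !expr1; have := rising_three_halves q.
  have : 0 <= q%:R :> R by [].
  rewrite natrD; move: (_ ^+ 2) (q%:R) => a x x0 ha.
  have : 8 <= (2 * E) ^+ 3 by nra.
  move: ((2 * E) ^+ 3) => w w8; nra.
rewrite ltnS => NM.
have h := IH N (ltnW NM).
have N0 : 0 < N.+2%:R :> R by rewrite ltr0n.
have -> : N.+4%:R / 2 = N.+2%:R / 2 + 1 :> R by rewrite -(natr1 N.+3) -(natr1 N.+2); field.
rewrite rising_addr1 ?gt_eqF ?divr_gt0//.
set r := rising _ _ in h *; set w := (_ + q%:R) / _.
rewrite [r * w / _]mulrAC [(_ * w) ^+ 2]exprMn {}/w.
set a := (r / _) ^+ 2 in h *.
have h2 : (N.+4%:R : R) ^+ N.+2 <= N.+2%:R ^+ N.+2 * E ^+ (2 * 1).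
  by apply: exprn_add2_le; rewrite ?mul1n.
have a0 : 0 <= a by exact: sqr_ge0.
have p2 d (x : R) : x ^+ d.+2 = x ^+ d * x ^+ 2 by rewrite -exprD addn2.
have -> : (N.+2%:R / 2 + q%:R) / (N.+2%:R / 2) = (N.+2%:R + 2 * q%:R) / N.+2%:R :> R.
  by field; rewrite gt_eqF.
set b := (_ + 2 * _) / _.
apply: (@le_trans _ _ (a * b ^+ 2 * (N.+2%:R ^+ N.+2 * E ^+ 2))).
  by rewrite ler_wpM2l// mulr_ge0// sqr_ge0.
have -> : a * b ^+ 2 * (N.+2%:R ^+ N.+2 * E ^+ 2) =
    (a * N.+2%:R ^+ N) * ((N.+2%:R + 2 * q%:R) ^+ 2 * E ^+ 2).
  rewrite /b (p2 N).
  by move: (N.+2%:R ^+ N) => u; field; rewrite gt_eqF.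
apply: (@le_trans _ _ (((q + N.+2)%:R ^+ N * (2 * E) ^+ N.+2) *
    ((N.+2%:R + 2 * q%:R) ^+ 2 * E ^+ 2))).
  by rewrite ler_wpM2r// mulr_ge0 ?sqr_ge0.
have -> : (q + N.+4)%:R ^+ N.+2 * (2 * E) ^+ N.+4 =
  ((q + N.+4)%:R ^+ N * (2 * E) ^+ N.+2) * ((2 * (q + N.+4)%:R) ^+ 2 * E ^+ 2) :> R.
  rewrite (p2 N) (p2 N.+2).
  by move: (_ ^+ N) (_ ^+ N.+2) => u v; ring.
have E0 : 0 <= 2 * E by rewrite mulr_ge0// expR_ge0.
have le1 : (q + N.+2)%:R <= (q + N.+4)%:R :> R by rewrite ler_nat; lia.
apply: ler_pM.
- by rewrite mulr_ge0// exprn_ge0.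
- by rewrite mulr_ge0 ?sqr_ge0.
- by rewrite ler_wpM2r ?exprn_ge0// lerXn2r ?nnegrE.
rewrite ler_wpM2r ?sqr_ge0// -!natrM -natrD lerXn2r ?nnegrE// ler_nat; lia.
Qed.

(** The left side is 1 / (lam eta)^2 for the eta of the header; squares remove the roots. Since q +
    N <= X / 2 and 4 q + N <= 2 X, everything reduces to powers of [X], which is close to k. *)
Lemma dual_value_le (n N k q : nat) : (n = N.+2)%N -> (2 <= N)%N -> (2 * q <= k.+1)%N ->
  ((2 * N).+1 * (2 * N).+2 <= k)%N ->
  16 * (N%:R / 2) * ((q.*2%:R + N%:R / 2) / (N%:R / 2)) ^+ (N + 4) *
    (rising (N%:R / 2 : R) q / q`!%:R) ^+ 2 <=
  (32 * E ^+ 3 * (Num.sqrt n%:R)^-1 * (Num.sqrt (2 * E) / n%:R) ^+ (n - 3)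
     * k%:R ^+ (n - 1)) ^+ 2.
Proof.
move=> -> {n} N2 qk kN; have E1 := expR1_ge1.
have [P NP] : exists P, N = P.+2 by exists (N - 2)%N; lia.
have e1 : ((2 * N).-1 <= (2 * N).+1)%N by lia.
have e2 : ((2 * N).+2 = (N + 4) + (N - 2))%N by lia.
have e3 : (N + 4 = (N - 2) + 6)%N by lia.
have e4 : (N.+2 - 3 = P.+1)%N by lia.
have e5 : (N.+2 - 1 = N.+1)%N by lia.
have e6 : ((2 * N).+2 = N.+1 * 2)%N by lia.
have e7 : ((2 * N).-1 = (2 * P.+1).+1)%N by lia.
have N0 : 0 < N%:R :> R by rewrite ltr0n; lia.
have u1 : 1 <= N%:R :> R by rewrite (ler_nat _ 1); lia.
have n0 : 0 < N.+2%:R :> R by rewrite ltr0n.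
have k0 : 0 < k%:R :> R by rewrite ltr0n; lia.
pose A : R := (rising (N%:R / 2 : R) q / q`!%:R) ^+ 2; rewrite -/A.
pose X : R := (k.+1 + 2 * N)%:R.
have A_le : A * N%:R ^+ (N - 2) <= (X / 2) ^+ (N - 2) * (2 * E) ^+ N.
  have := rising_half_le P q; rewrite -NP -/A NP subSS subSS subn0 -NP => /le_trans; apply.
  rewrite ler_wpM2r ?exprn_ge0 ?mulr_ge0 ?expR_ge0// lerXn2r ?nnegrE ?divr_ge0//.
  by rewrite ler_pdivlMr// -natrM ler_nat; lia.
have -> : (q.*2%:R + N%:R / 2) / (N%:R / 2) = (4 * q + N)%:R / N%:R :> R.
  by rewrite -muln2 natrD !natrM; field; rewrite gt_eqF.
have z_le : ((4 * q + N)%:R / N%:R) ^+ (N + 4) <= (2 * X) ^+ (N + 4) / N%:R ^+ (N + 4) :> R.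
  rewrite expr_div_n ler_pM2r ?invr_gt0 ?exprn_gt0// lerXn2r ?nnegrE ?mulr_ge0//.
  by rewrite -natrM ler_nat; lia.
(* As X = k (1 + (2N + 1) / k), the threshold on k makes the exponent (2N + 1) (2N + 2) / k at most
   1. *)
have X_le : X ^+ (2 * N).+2 <= E * k%:R ^+ (2 * N).+2.
  have -> : X = k%:R * (1 + (2 * N).+1%:R / k%:R).
    by rewrite mulrDr mulr1 mulrCA divff ?gt_eqF// mulr1 -natrD /X; congr _%:R; lia.
  rewrite exprMn mulrC ler_wpM2r ?exprn_ge0//.
  rewrite (le_trans (exprn_le_expR _ _)) ?divr_ge0// ler_expR mulrAC ler_pdivrMr// mul1r.
  by rewrite -natrM ler_nat.
have n_le : N.+2%:R ^+ (2 * N).-1 <= N%:R ^+ (2 * N).-1 * E ^+ (2 * 2) :> R.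
  by apply: exprn_add2_le; lia.
have -> : (32 * E ^+ 3 * (Num.sqrt N.+2%:R)^-1 * (Num.sqrt (2 * E) / N.+2%:R) ^+ (N.+2 - 3)
     * k%:R ^+ (N.+2 - 1)) ^+ 2 =
   1024 * E ^+ 6 * (2 * E) ^+ P.+1 * k%:R ^+ (2 * N).+2 / N.+2%:R ^+ (2 * N).-1 :> R.
  rewrite e4 e5 e6 e7.
  have s1 : Num.sqrt N.+2%:R ^+ 2 = N.+2%:R :> R by rewrite sqr_sqrtr// ltW.
  have s2 : Num.sqrt (2 * E) ^+ 2 = 2 * E by rewrite sqr_sqrtr// mulr_ge0// expR_ge0.
  have sq4 (a b c d : R) : (a * b * c * d) ^+ 2 = a ^+ 2 * b ^+ 2 * c ^+ 2 * d ^+ 2 by ring.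
  have sq1 (a b : R) d : ((a / b) ^+ d) ^+ 2 = (a ^+ 2) ^+ d / (b ^+ 2) ^+ d.
    by rewrite exprAC !expr_div_n.
  rewrite sq4 exprVn s1 sq1 s2 (exprM k%:R N.+1 2) [_ ^+ (2 * P.+1).+1]exprS (exprM _ 2).
  have : (N.+2%:R ^+ 2) ^+ P.+1 != 0 :> R by rewrite gt_eqF// exprn_gt0// exprn_gt0.
  have : N.+2%:R != 0 :> R by rewrite gt_eqF.
  move: (k%:R ^+ _) ((2 * E) ^+ _) (_ ^+ P.+1) => b c d.
  move: (N.+2%:R) => a a0 d0; by field; rewrite a0 d0.
rewrite ler_pdivlMr ?exprn_gt0//.
(* Together with the N of lam = N / 2, the factor N^(2N + 1) splits into N^(N + 4) for [z_le] and
   N^(N - 2) for [A_le]. *)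
pose T := (16 * (N%:R / 2) * ((4 * q + N)%:R / N%:R) ^+ (N + 4) * A) * N%:R ^+ (2 * N).+1.
have A0 : 0 <= A by exact: sqr_ge0.
have X0 : 0 <= X by [].
have T_le : T <= 512 * (2 * E) ^+ N * X ^+ (2 * N).+2.
  have -> : T = 8 * (((4 * q + N)%:R / N%:R) ^+ (N + 4) * N%:R ^+ (N + 4)) * (A * N%:R ^+ (N - 2)).
    have NE : N%:R * N%:R ^+ (2 * N).+1 = N%:R ^+ (N + 4) * N%:R ^+ (N - 2) :> R.
      by rewrite -exprS -exprD e2.
    rewrite /T; move: NE; move: (N%:R ^+ (2 * N).+1) (N%:R ^+ (N + 4)) (N%:R ^+ (N - 2)) => a b c abc.
    set Z := _ ^+ (N + 4).
    have -> : 16 * (N%:R / 2) * Z * A * a = 8 * Z * A * (N%:R * a) by field.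
    by rewrite abc; ring.
  have -> : 512 * (2 * E) ^+ N * X ^+ (2 * N).+2 =
      8 * (2 * X) ^+ (N + 4) * ((X / 2) ^+ (N - 2) * (2 * E) ^+ N).
    rewrite e2 e3 (exprMn _ 2 X) expr_div_n !exprD.
    have : (2 ^+ (N - 2) : R) != 0 by rewrite expf_neq0.
    move: ((2 * E) ^+ N) (2 ^+ (N - 2)) (X ^+ (N - 2)) => a b c b0.
    by field.
  apply: ler_pM A_le.
  - by rewrite mulr_ge0// mulr_ge0// exprn_ge0// divr_ge0.
  - by rewrite mulr_ge0// exprn_ge0.
  by rewrite ler_pM2l// -ler_pdivlMr// exprn_gt0.
have L0 : 0 <= 16 * (N%:R / 2) * ((4 * q + N)%:R / N%:R) ^+ (N + 4) * A.
  by rewrite mulr_ge0// mulr_ge0 ?exprn_ge0 ?divr_ge0// mulr_ge0// divr_ge0.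
apply: (@le_trans _ _ (T * E ^+ 4)).
  rewrite /T -[leRHS]mulrA ler_wpM2l// (le_trans n_le)// ler_wpM2r ?exprn_ge0 ?expR_ge0//.
  by rewrite ler_weXn2l.
have E0 : 0 < E by exact: expR_gt0.
apply: (@le_trans _ _ (512 * (2 * E) ^+ N * X ^+ (2 * N).+2 * E ^+ 4)).
  by rewrite ler_wpM2r// exprn_ge0// ltW.
apply: (@le_trans _ _ (512 * (2 * E) ^+ N * (E * k%:R ^+ (2 * N).+2) * E ^+ 4)).
  apply: ler_wpM2r; first by rewrite exprn_ge0// ltW.
  have E2 : 0 <= 2 * E by lra.
  exact: ler_wpM2l (mulr_ge0 (ler0n _ 512) (exprn_ge0 N E2)) _ _ X_le.
(* Here 512 (2e)^N e e^4 = (32 e^3)^2 (2e)^(N - 1), which is where the constant 32 e^3 comes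
   from. *)
rewrite NP [(2 * E) ^+ P.+2]exprS.
by move: ((2 * E) ^+ P.+1) (k%:R ^+ _) => a b; rewrite le_eqVlt; apply/orP; left; apply/eqP; ring.
Qed.
End Estimates.

(** * Choice of the parameters and conclusion *)

Theorem corollary1p4 (R : realType) :
  exists C : R, 0 < C /\
    forall n : nat, (6 <= n)%N ->
      exists k0 : nat, forall k : nat, (k0 <= k)%N ->
        (N_LP R n k <=
         (C * n%:R `^ (- (1 / 2))
            * (Num.sqrt (2 * expR 1) / n%:R) ^+ (n - 3)
            * k%:R ^+ (n - 1))%:E)%E.
Proof.
have E0 : 0 < expR 1 :> R by exact: expR_gt0.
exists (32 * expR 1 ^+ 3); split; first by rewrite mulr_gt0// exprn_gt0.
move=> n n6; pose N := (n - 2)%N; have nN : n = N.+2 by rewrite /N; lia.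
have n3 : (3 <= n)%N by lia.
exists ((2 * N).+1 * (2 * N).+2)%N => k kN.
(* Thus 2q is the even one among k and k + 1. *)
pose q := uphalf k.
have k1 : (0 < k)%N by rewrite (leq_trans _ kN)// muln_gt0.
have kq : (0 < k <= q.*2)%N.
  by rewrite k1/= /q uphalf_half doubleD -[k in (k <= _)%N]odd_double_half; lia.
have qk : (2 * q <= k.+1)%N.
  by rewrite mul2n /q uphalf_half doubleD -[k in (_ <= k.+1)%N]odd_double_half; lia.
have q0 : (0 < q)%N by rewrite -double_gt0; case/andP: kq => k0; exact: leq_trans.
have lamN : (n%:R - 2) / 2 = N%:R / 2 :> R by rewrite nN -addn2 natrD addrK.
have N4 : (4 <= N)%N by lia.
have [B B0 bound] := @gegenker_bound R ((n%:R - 2) / 2) N q lamN N4 q0.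
move: bound; set lam := (n%:R - 2) / 2; set H := 16 * _ * _ * _ => bound.
have l0 : 0 < lam by rewrite /lam lamN divr_gt0// ltr0n; lia.
have y0 : (gegenbauer lam q).[0] ^+ 2 = (rising (N%:R / 2 : R) q / q`!%:R) ^+ 2.
  by rewrite gegenbauer_at0 exprMn -signr_odd sqrr_sign mul1r /lam lamN.
have H0 : 0 < H.
  rewrite /H y0 mulr_gt0//; last first.
    rewrite exprn_gt0// divr_gt0 ?ltr0n ?fact_gt0// prodr_gt0// => i _.
    by rewrite ltr_wpDr// -lamN.
  apply: mulr_gt0; first by rewrite mulr_gt0// exprn_gt0.
  by rewrite exprn_gt0// divr_gt0// ltr_wpDl.
have sH : 0 < Num.sqrt H by rewrite sqrtr_gt0.
apply: ge_ereal_sup => x [m [a [feas ->]]]; rewrite lee_fin.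
(* The choice is eta = 1 / sqrt H, as permitted by [bound]. *)
have a0_ge : lam * (Num.sqrt H)^-1 <= a 0%N.
  apply: (LP_feasible_coef0_ge n3 kq B0 _ _ feas); first by rewrite invr_ge0 ltW.
  by move=> t /bound; rewrite [_^-1 * _]mulrC ler_pdivrMr// mul1r.
(* This makes a_0 positive, so that inversion reverses the inequality and the default inverse of 0
   never occurs. *)
have la : 0 < lam * (Num.sqrt H)^-1 by rewrite mulr_gt0// invr_gt0.
have -> : n%:R `^ (- (1 / 2)) = (Num.sqrt n%:R)^-1 :> R.
  by rewrite powRN mul1r powR12_sqrt.
apply: (@le_trans _ _ (Num.sqrt H / lam)).
  rewrite -[Num.sqrt H]invrK -invfM mulrC lef_pV2 ?posrE// 1?mulrC//.
  exact: lt_le_trans la _.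
have s0 : 0 <= Num.sqrt H / lam by rewrite divr_ge0// ltW.
set c := 32 * _ * _ * _ * _.
have c0 : 0 <= c.
  apply: mulr_ge0; last by rewrite exprn_ge0.
  apply: mulr_ge0; last by rewrite exprn_ge0// divr_ge0// sqrtr_ge0.
  apply: mulr_ge0; last by rewrite invr_ge0 sqrtr_ge0.
  by rewrite mulr_ge0// exprn_ge0// ltW.
rewrite -(@ler_pXn2r _ 2) ?nnegrE// /c.
rewrite expr_div_n sqr_sqrtr ?(ltW H0)//.
apply: le_trans (dual_value_le nN (leq_trans _ N4) qk kN) => //.
rewrite /H y0 /lam lamN.
set A := (rising _ _ / _) ^+ 2; set z := _ ^+ (N + 4).
have N0 : N%:R != 0 :> R by rewrite pnatr_eq0 -lt0n (leq_trans _ N4).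
by rewrite le_eqVlt; apply/orP; left; apply/eqP; field.
Qed.
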